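(* Let $\Delta=\Delta^{\vec\varepsilon}$ be a $B\times B$ transition matrix whose entries are analytically parameterized by a real variable vector $\vec\varepsilon\in\mathbb{R}^m$, let $\Phi:\{1,\dots,B\}\to\{1,\dots,A\}$, and let $Z=Z^{\vec\varepsilon}=\Phi(Y^{\vec\varepsilon})$ be the hidden Markov chain determined by $\Delta^{\vec\varepsilon}$ and $\Phi$. Suppose that at $\vec\varepsilon=\vec\varepsilon_0$: (1) for every $a\in\{1,\dots,A\}$ there is at least one $j$ with $\Phi(j)=a$ such that the $j$-th column of $\Delta$ is strictly positive; and (2) every column of $\Delta$ is either all zero or strictly positive. Then the entropy rate $H(Z)$ is a real analytic function of $\vec\varepsilon$ at $\vec\varepsilon_0$.
   Context: A stationary process $Y$ with finite state set and distribution $p$ has entropy rate $H(Y)=\lim_{n\to\infty}-E_p(\log p(y_0|y_{-n}^{-1}))$, where $y_m^n$ denotes $y_m,y_{m+1},\dots,y_n$. $Y=Y^{\vec\varepsilon}$ is a stationary first order Markov chain on $\{1,\dots,B\}$ with transition probabilities $\Delta(i,j)=p(y_1=j|y_0=i)$ (indices $i$ for rows, $j$ for columns). The hidden Markov chain is the stationary process $Z=\Phi(Y)$, i.e. $Z_n=\Phi(Y_n)$. Analytic parametrization: each entry of $\Delta^{\vec\varepsilon}$ is a real analytic function of $\vec\varepsilon$ in a neighborhood of $\vec\varepsilon_0$, each row of $\Delta^{\vec\varepsilon}$ sums to $1$, and $\Delta^{\vec\varepsilon_0}$ is stochastic (nonnegative entries). A function is real analytic at a point if it admits a convergent Taylor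 series representation in a real neighborhood of the point. $H(Z^{\vec\varepsilon})$ is defined for those $\vec\varepsilon$ for which $\Delta^{\vec\varepsilon}$ is stochastic; being real analytic at $\vec\varepsilon_0$ means that there is a power series centered at $\vec\varepsilon_0$, convergent in a real neighborhood of $\vec\varepsilon_0$, whose sum equals $H(Z^{\vec\varepsilon})$ at every $\vec\varepsilon$ in that neighborhood for which $\Delta^{\vec\varepsilon}$ is stochastic. *)

(* Defs.v *)
From mathcomp Require Import all_boot all_order all_algebra finmap.
From mathcomp Require Import all_classical all_reals all_analysis.
From mathcomp.analysis.showcase Require summability.

Set Implicit Arguments.
Unset Strict Implicit.
Unset Printing Implicit Defensive.

Import Order.TTheory GRing.Theory Num.Theory.
Import numFieldNormedType.Exports.

Local Open Scope classical_set_scope.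
Local Open Scope ring_scope.

Section Analyticity.
Context {R : realType} {m : nat}.

(* The multi-index [a] stands for the monomial
   x_0 ^ a_0 * ... * x_(m-1) ^ a_(m-1). *)
Definition power_series_term (c : {ffun 'I_m -> nat} -> R) (h : 'rV[R]_m)
    (a : {ffun 'I_m -> nat}) : R :=
  c a * \prod_(i < m) h 0 i ^+ a i.

(* Multiple power series are summed unconditionally, i.e. along the net of
   finite sets of multi-indices; over the reals this is absolute convergence. *)
Definition power_series_sums (c : {ffun 'I_m -> nat} -> R) (h : 'rV[R]_m)
    (l : R) : Prop :=
  summability.partial_sum (power_series_term c h) @ summability.totally --> l.

(* The function [f] is only meaningful on [D], which need not be a neighborhood
   of [x0]: the series has to converge on a whole neighborhood of [x0], but its
   sum is compared with [f] on [D] only. *)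
Definition real_analytic_within (D : set 'rV[R]_m) (f : 'rV[R]_m -> R)
    (x0 : 'rV[R]_m) : Prop :=
  exists c : {ffun 'I_m -> nat} -> R,
    \forall x \near x0, exists l : R,
      power_series_sums c (x - x0) l /\ (D x -> f x = l).

Definition real_analytic_at (f : 'rV[R]_m -> R) (x0 : 'rV[R]_m) : Prop :=
  real_analytic_within setT f x0.

Definition stochastic (B : nat) (Q : 'M[R]_B) : Prop :=
  (forall i j, 0 <= Q i j) /\ (forall i, \sum_j Q i j = 1).

(* Nonnegativity of the entries is required at [e0] only. *)
Definition analytic_parametrization (B : nat) (Delta : 'rV[R]_m -> 'M[R]_B)
    (e0 : 'rV[R]_m) : Prop :=
  [/\ forall i j, \forall e \near e0, real_analytic_at (fun x => Delta x i j) e,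
      \forall e \near e0, forall i, \sum_j Delta e i j = 1
    & stochastic (Delta e0)].

End Analyticity.

Section Processes.
Context {R : realType} {d : measure_display} {T : measurableType d}.

(* Takes the junk value 0 when [F] is a null event. *)
Definition cond_prob (P : probability T R) (E F : set T) : R :=
  fine (P (E `&` F)) / fine (P F).

(* The random word (Y_s, ..., Y_(s+n-1)). *)
Definition block {S : Type} (Y : int -> T -> S) (s : int) (n : nat) (t : T) :
    n.-tuple S :=
  [tuple Y (s + Posz i) t | i < n].

Definition cylinder {S : Type} (Y : int -> T -> S) (s : int) (n : nat)
    (w : n.-tuple S) : set T :=
  block Y s n @^-1` [set w].

Definition stationary_process {S : finType} (P : probability T R)
    (Y : int -> T -> S) : Prop :=
  (forall k a, measurable (Y k @^-1` [set a])) /\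
  (forall (k l : int) (n : nat) (w : n.-tuple S),
     P (cylinder Y k w) = P (cylinder Y l w)).

(* The next state given any possible finite past (Y_s, ..., Y_(s+n)) = w is
   distributed according to the row of [Q] indexed by the last letter of [w]. *)
Definition stationary_markov_chain {B : nat} (P : probability T R)
    (Y : int -> T -> 'I_B) (Q : 'M[R]_B) : Prop :=
  stationary_process P Y /\
  (forall (s : int) (n : nat) (w : n.+1.-tuple 'I_B) (j : 'I_B),
     P (cylinder Y s w) != 0%E ->
     cond_prob P (Y (s + Posz n.+1) @^-1` [set j]) (cylinder Y s w) =
       Q (tnth w ord_max) j).

(* The random variable p(y_0 | y_(-n), ..., y_(-1)). *)
Definition cond_likelihood {S : finType} (P : probability T R)
    (Y : int -> T -> S) (n : nat) (t : T) : R :=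
  cond_prob P (Y 0 @^-1` [set Y 0 t])
    (cylinder Y (- Posz n) (block Y (- Posz n) n t)).

(* The values of [ln] at nonpositive arguments are irrelevant, since
   [cond_likelihood P Y n] is positive outside a null event. *)
Definition entropy_rate {S : finType} (P : probability T R)
    (Y : int -> T -> S) : R :=
  lim ((fun n : nat => - fine 'E_P[fun t => ln (cond_likelihood P Y n t)])
         @ \oo).

End Processes.

(* Main.v *)
Require Import Defs.
From mathcomp Require Import all_boot all_order all_algebra finmap.
From mathcomp Require Import all_classical all_reals all_analysis.
From mathcomp Require Import ring lra.
From mathcomp.analysis.showcase Require summability.

Set Implicit Arguments.
Unset Strict Implicit.
Unset Printing Implicit Defensive.

Import Order.TTheory GRing.Theory Num.Theory.
Import numFieldNormedType.Exports.

Local Open Scope classical_set_scope.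
Local Open Scope ring_scope.

(* The norm [sum_a |c_a| r^|a|] makes the power series at [e0] a Banach algebra,
   which takes the place of the functions analytic on a complex neighborhood:
   [norm_le e0 r M f] says that [f] is, on the cube of radius [r], a uniform
   limit of polynomials of norm at most [M].  This is stable under the algebra
   operations, under [1 / f] and [ln f] for [f] close to a positive constant, and
   under limits, and it implies analyticity.

   Let [D_a] be [Delta] with the columns outside [Phi^-1(a)] erased.  For a word
   [w = a_1 ... a_n] the vector [D_(a_1) ... D_(a_n) 1] is, at [e0], positive
   with entries of comparable size, because the columns of [Delta] are positive
   or zero and each [D_a] has a positive one.  Multiplication by [D_a] acts on
   such vectors as an averaging by Markov kernels satisfying Doeblin's condition
   uniformly, so it contracts ratios; the contraction survives a perturbation
   that is small in norm.  Hence the weights of these kernels stay close to their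
   values at [e0] for all words, and the probability [next_mass] of the next
   letter forgets the initial state at a geometric rate, in norm.

   Let [E_n i] be the entropy of the letter [n] given the previous ones, for the
   chain started at [i].  By the above, [E_(n+1) - Delta E_n] has geometrically
   small norm: the sum of the norms of the masses of all words of length [n]
   grows only like [(1 + small)^n].  As [Delta] itself satisfies Doeblin's
   condition, [E_n i] converges in norm to a limit that does not depend on [i],
   and at stochastic [Delta] this limit is the entropy rate.  In this way the
   stationary distribution is never needed as a function of the parameter. *)

(** * Functions with a bounded power series norm *)

Section Polynomials.
Context {R : realType} {m : nat}.

Definition mdegree (a : {ffun 'I_m -> nat}) : nat := (\sum_i a i)%N.

(* A polynomial is a list of terms, repetitions of a monomial being allowed. *)
Definition poly_eval (p : seq (R * {ffun 'I_m -> nat})) (h : 'rV[R]_m) : R :=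
  \sum_(t <- p) t.1 * \prod_(i < m) h 0 i ^+ t.2 i.

Definition poly_norm (r : R) (p : seq (R * {ffun 'I_m -> nat})) : R :=
  \sum_(t <- p) `|t.1| * r ^+ mdegree t.2.

Definition poly_coef (p : seq (R * {ffun 'I_m -> nat})) a : R :=
  \sum_(t <- p | t.2 == a) t.1.

Definition poly_mul (p q : seq (R * {ffun 'I_m -> nat})) :=
  [seq (t.1 * u.1, [ffun i => (t.2 i + u.2 i)%N])
     | t : R * {ffun 'I_m -> nat} <- p, u : R * {ffun 'I_m -> nat} <- q].

Lemma poly_eval_mul p q h :
  poly_eval (poly_mul p q) h = poly_eval p h * poly_eval q h.
Proof.
rewrite /poly_eval big_allpairs_dep mulr_suml; apply: eq_bigr => t _.
rewrite mulr_sumr; apply: eq_bigr => u _ /=.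
rewrite mulrACA -big_split /=; congr (_ * _); apply: eq_bigr => i _.
by rewrite ffunE exprD.
Qed.

(** An equality, because terms with the same monomial are never merged and no cancellation can
    occur. *)
Lemma poly_norm_mul r p q :
  poly_norm r (poly_mul p q) = poly_norm r p * poly_norm r q.
Proof.
rewrite /poly_norm big_allpairs_dep mulr_suml; apply: eq_bigr => t _.
rewrite mulr_sumr; apply: eq_bigr => u _ /=.
rewrite normrM mulrACA -exprD; congr (_ * _ ^+ _).
by rewrite /mdegree -big_split; apply: eq_bigr => i _; rewrite ffunE.
Qed.

Lemma poly_norm_ge0 r p : 0 <= r -> 0 <= poly_norm r p.
Proof. by move=> r0; apply: sumr_ge0 => t _; rewrite mulr_ge0// exprn_ge0. Qed.

Lemma monomial_le (r : R) (h : 'rV[R]_m) (a : {ffun 'I_m -> nat}) :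
  (forall i, `|h 0 i| <= r) -> `|\prod_(i < m) h 0 i ^+ a i| <= r ^+ mdegree a.
Proof.
move=> hr; rewrite normr_prod /mdegree -prodrXr; apply: ler_prod => i _.
by rewrite normr_ge0 normrX lerXn2r ?nnegrE//; exact: le_trans (hr i).
Qed.

Lemma poly_eval_le (r : R) p (h : 'rV[R]_m) : (forall i, `|h 0 i| <= r) ->
  `|poly_eval p h| <= poly_norm r p.
Proof.
move=> hr; apply: (le_trans (ler_norm_sum _ _ _)); apply: ler_sum => t _.
by rewrite normrM ler_wpM2l// monomial_le.
Qed.

End Polynomials.

Section NormLe.
Context {R : realType} {m : nat} (x0 : 'rV[R]_m) (r : R).

Definition cube : set 'rV[R]_m := [set x | forall i, `|x 0 i - x0 0 i| <= r].

(* [f] belongs on the cube to the Banach algebra of power series with weighted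
   l^1 norm [sum_a |c_a| r^|a|], and its norm is at most [M]. *)
Definition norm_le (M : R) (f : 'rV[R]_m -> R) : Prop :=
  forall eta : R, 0 < eta -> exists2 p, poly_norm r p <= M &
    forall x, cube x -> `|f x - poly_eval p (x - x0)| <= eta.

Lemma cubeB x : cube x -> forall i, `|(x - x0) 0 i| <= r.
Proof. by move=> hx i; rewrite !mxE; exact: hx. Qed.

Hypothesis r0 : 0 <= r.

Lemma cube_center : cube x0.
Proof. by move=> i; rewrite subrr normr0. Qed.

Lemma norm_le_eval M f x : norm_le M f -> cube x -> `|f x| <= M.
Proof.
move=> hf hx; apply/ler_addgt0Pl => eta /hf[p pM fp].
rewrite -(subrK (poly_eval p (x - x0)) (f x)).
apply: (le_trans (ler_normD _ _)); apply: lerD; first exact: fp.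
exact: le_trans (poly_eval_le _ (cubeB hx)) pM.
Qed.

Lemma norm_le_ge0 M f : norm_le M f -> 0 <= M.
Proof. by move=> hf; exact: le_trans (norm_le_eval hf cube_center). Qed.

Lemma norm_le_ext M f g : (forall x, cube x -> f x = g x) ->
  norm_le M f -> norm_le M g.
Proof.
move=> fg hf eta /hf[p pM fp]; exists p => // x hx.
by rewrite -fg// fp.
Qed.

Lemma norm_leW M N f : M <= N -> norm_le M f -> norm_le N f.
Proof. by move=> MN hf eta /hf[p pM fp]; exists p => //; exact: le_trans MN. Qed.

(** The ball of radius [M] is closed under uniform convergence on the cube, since a polynomial close
    to [g] is close to [f]. Inverses, logarithms and limits are all obtained through this
    closure. *)
Lemma norm_le_lim M f : (forall eta : R, 0 < eta -> exists2 g, norm_le M g &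
    forall x, cube x -> `|f x - g x| <= eta) ->
  norm_le M f.
Proof.
move=> hf eta eta0; have [g hg fg] := hf _ (divr_gt0 eta0 (ltr0n R 2)).
have [p pM gp] := hg _ (divr_gt0 eta0 (ltr0n R 2)).
exists p => // x hx; rewrite (splitr eta).
rewrite -(subrKA (g x)); apply: (le_trans (ler_normD _ _)).
by apply: lerD; [exact: fg|exact: gp].
Qed.

Lemma norm_le_cst k : norm_le `|k| (fun=> k).
Proof.
move=> eta eta0; exists [:: (k, [ffun=> 0%N])].
  rewrite /poly_norm big_seq1 /= /mdegree big1 ?expr0 ?mulr1// => i _.
  by rewrite ffunE.
move=> x _; rewrite /poly_eval big_seq1 /= big1 ?mulr1 ?subrr ?normr0 ?ltW//.
by move=> i _; rewrite ffunE expr0.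
Qed.

Lemma norm_le0 : norm_le 0 (fun=> 0).
Proof. by rewrite -{1}(@normr0 _ R); exact: norm_le_cst. Qed.

Lemma norm_leD M N f g : norm_le M f -> norm_le N g ->
  norm_le (M + N) (fun x => f x + g x).
Proof.
move=> hf hg eta eta0.
have [p pM fp] := hf _ (divr_gt0 eta0 (ltr0n R 2)).
have [q qN gq] := hg _ (divr_gt0 eta0 (ltr0n R 2)).
exists (p ++ q); first by rewrite /poly_norm big_cat/= lerD.
move=> x hx; rewrite /poly_eval big_cat/= opprD addrACA (splitr eta).
by apply: (le_trans (ler_normD _ _)); apply: lerD; [exact: fp|exact: gq].
Qed.

Lemma norm_leM M N f g : norm_le M f -> norm_le N g ->
  norm_le (M * N) (fun x => f x * g x).
Proof.
move=> hf hg eta eta0.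
have M0 := norm_le_ge0 hf; have N0 := norm_le_ge0 hg.
(* The error of the product is at most [eta / (M + N + 1) * (M + N)]; the extra 1 keeps the
   denominator positive when both bounds vanish. *)
have K0 : 0 < M + N + 1 by lra.
have [p pM fp] := hf _ (divr_gt0 eta0 K0).
have [q qN gq] := hg _ (divr_gt0 eta0 K0).
exists (poly_mul p q).
  by rewrite poly_norm_mul ler_pM// poly_norm_ge0.
move=> x hx; rewrite poly_eval_mul.
set P := poly_eval p _; set Q := poly_eval q _.
have -> : f x * g x - P * Q = (f x - P) * Q + f x * (g x - Q) by ring.
have hQ : `|Q| <= N by exact: le_trans (poly_eval_le _ (cubeB hx)) qN.
have hfx := norm_le_eval hf hx.
apply: (le_trans (ler_normD _ _)); rewrite !normrM.
apply: (@le_trans _ _ (eta / (M + N + 1) * N + M * (eta / (M + N + 1)))).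
  by apply: lerD; apply: ler_pM => //; [exact: fp|exact: gq].
rewrite (mulrC M) -mulrDr mulrAC ler_pdivrMr// ler_wpM2l ?ltW//.
lra.
Qed.

Lemma norm_leN M f : norm_le M f -> norm_le M (fun x => - f x).
Proof.
move=> hf; have := norm_leM (norm_le_cst (-1)) hf.
rewrite normrN1 mul1r; apply: norm_le_ext => x _; by rewrite mulN1r.
Qed.

Lemma norm_leB M N f g : norm_le M f -> norm_le N g ->
  norm_le (M + N) (fun x => f x - g x).
Proof. by move=> hf /norm_leN; exact: norm_leD. Qed.

Lemma norm_leZ k M f : norm_le M f -> norm_le (`|k| * M) (fun x => k * f x).
Proof. by move=> hf; exact: norm_leM (norm_le_cst k) hf. Qed.

Lemma norm_le_sum (I : Type) (s : seq I) (Q : pred I) (M : I -> R)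
    (f : I -> 'rV[R]_m -> R) :
  (forall i, Q i -> norm_le (M i) (f i)) ->
  norm_le (\sum_(i <- s | Q i) M i) (fun x => \sum_(i <- s | Q i) f i x).
Proof.
move=> hf; elim: s => [|i s IH].
  by rewrite big_nil; apply: norm_le_ext norm_le0 => x _; rewrite big_nil.
rewrite big_cons; case: ifPn => [Qi|Qi].
  by apply: norm_le_ext (norm_leD (hf _ Qi) IH) => x _; rewrite big_cons Qi.
by apply: norm_le_ext IH => x _; rewrite big_cons (negPf Qi).
Qed.

Lemma norm_leX M f n : norm_le M f -> norm_le (M ^+ n) (fun x => f x ^+ n).
Proof.
move=> hf; elim: n => [|n IH].
  rewrite expr0 -(@normr1 R); apply: norm_le_ext (norm_le_cst 1) => x _.
  by rewrite expr0.
rewrite exprS; apply: norm_le_ext (norm_leM hf IH) => x _; by rewrite exprS.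
Qed.

Lemma geometric_sum_le (M : R) n : 0 <= M < 1 ->
  \sum_(k < n) M ^+ k <= (1 - M)^-1.
Proof.
move=> /andP[M0 M1]; have h : 0 < 1 - M by lra.
have := subrX1 M n; rewrite -[LHS]opprB -[_ - 1 in RHS]opprB mulNr => /oppr_inj e.
rewrite -(ler_pM2l h) -e divff ?gt_eqF// gerBl exprn_ge0//.
Qed.

Lemma expr_small (M eta : R) : 0 <= M < 1 -> 0 < eta -> exists n, M ^+ n <= eta.
Proof.
move=> /andP[M0 M1] eta0.
have : M ^+ n @[n --> \oo] --> (0 : R) by apply: cvg_expr; rewrite ger0_norm.
move=> /cvgrPdist_le/(_ _ eta0)[n _ /(_ n (leqnn n))].
rewrite sub0r normrN ger0_norm ?exprn_ge0// => h; by exists n.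
Qed.

(** Neumann series in [1 - f]: the norms of its partial sums are bounded by geometric sums in [M],
    and its remainder [(1 - f x) ^+ n / f x] tends to 0 uniformly, because [f] is at least [1 - M]
    on the cube. *)
Lemma norm_le_inv M f : M < 1 -> norm_le M (fun x => 1 - f x) ->
  norm_le (1 - M)^-1 (fun x => (f x)^-1).
Proof.
move=> M1 hf; have M0 := norm_le_ge0 hf.
apply: norm_le_lim => eta eta0.
have h : 0 < 1 - M by lra.
have [|n hn] := expr_small (M := M) _ (mulr_gt0 eta0 h); first by rewrite M0.
exists (fun x => \sum_(k < n) (1 - f x) ^+ k).
  apply: norm_leW (norm_le_sum (index_enum 'I_n) (fun i _ => norm_leX i hf)).
  by apply: geometric_sum_le; rewrite M0.
move=> x hx; have fx := norm_le_eval hf hx.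
have fx0 : 1 - M <= f x by move: fx; rewrite ler_norml; lra.
have fxp : 0 < f x by exact: lt_le_trans h fx0.
have := subrX1 (1 - f x) n; have -> : 1 - f x - 1 = - f x by ring.
move=> e; have -> : (f x)^-1 - \sum_(i < n) (1 - f x) ^+ i = (1 - f x) ^+ n / f x.
  rewrite -[in RHS](subrK 1 (_ ^+ n)) e; by field; rewrite gt_eqF.
rewrite normrM normfV (gtr0_norm fxp) normrX ler_pdivrMr//.
apply: (@le_trans _ _ (M ^+ n)); first by rewrite lerXn2r.
by apply: (le_trans hn); rewrite ler_wpM2l// ltW.
Qed.

End NormLe.

(** * Logarithms in the power series norm *)

Section Logarithm.
Context {R : realType} {m : nat} (x0 : 'rV[R]_m) (r : R).
Hypothesis r0 : 0 <= r.

Lemma ln_sub_le (a b : R) : 0 < a -> 0 < b -> ln b - ln a <= (b - a) / a.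
Proof.
move=> a0 b0; rewrite -ln_div ?posrE//.
have e : b / a = 1 + (b - a) / a by field; rewrite gt_eqF.
rewrite e; apply: le_ln1Dx; rewrite -subr_gt0 opprK addrC -e.
exact: divr_gt0.
Qed.

(** The tangent inequality, used at [a] and at [b], encloses [ln b - ln a] between [(b - a) / b] and
    [(b - a) / a], whose difference is the right-hand side. *)
Lemma ln_increment_le (a b : R) : 0 < a -> 0 < b ->
  `|ln b - ln a - (b - a) / a| <= (b - a) ^+ 2 / (a * b).
Proof.
move=> a0 b0; have h1 := ln_sub_le a0 b0; have h2 := ln_sub_le b0 a0.
rewrite ler_norml.
have -> : (b - a) ^+ 2 / (a * b) = (b - a) / a - (b - a) / b.
  by field; rewrite !gt_eqF.
have e : (a - b) / b = - ((b - a) / b) by field; rewrite gt_eqF.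
have h3 : 0 <= (b - a) / a - (b - a) / b.
  have -> : (b - a) / a - (b - a) / b = (b - a) ^+ 2 / (a * b).
    by field; rewrite !gt_eqF.
  by rewrite divr_ge0 ?sqr_ge0// mulr_ge0// ltW.
by apply/andP; split; lra.
Qed.

(* Along the segment from [1] to [1 + g], cut into [n] steps, the increments of
   [ln] are replaced by those of its first-order expansion. *)
Lemma norm_le_ln1D M g : M < 1 -> norm_le x0 r M g ->
  norm_le x0 r (M / (1 - M)) (fun x => ln (1 + g x)).
Proof.
move=> M1 hg; have M0 := norm_le_ge0 r0 hg; have h : 0 < 1 - M by lra.
apply: norm_le_lim => eta eta0.
(* The [n] steps have total error at most [M ^+ 2 / (1 - M) ^+ 2 / n]; since [M < 1], any [n] above
   [K] brings it below [eta]. *)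
pose K := (eta * (1 - M) ^+ 2)^-1.
have K0 : 0 < K by rewrite invr_gt0 mulr_gt0// exprn_gt0.
pose n := (Num.bound K).+1.
have nK : K <= n%:R.
  apply: (le_trans (ltW (archi_boundP (ltW K0)))).
  by rewrite ler_nat /n leqnSn.
have n0 : 0 < n%:R :> R by rewrite ltr0n.
pose a (k : nat) x := 1 + (k%:R / n%:R) * g x.
have step (k : nat) : (k <= n)%N -> norm_le x0 r M (fun x => 1 - a k x).
  move=> kn; apply: (@norm_le_ext _ _ _ _ _ (fun x => (- (k%:R / n%:R)) * g x)).
    by move=> x _; rewrite /a; ring.
  apply: norm_leW (norm_leZ r0 _ hg).
  rewrite normrN ger0_norm ?divr_ge0// ler_piMl// ler_pdivrMr// mul1r ler_nat//.
exists (fun x => \sum_(k < n) (n%:R^-1 * g x) / a k x).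
  apply: (@norm_leW _ _ _ _ (\sum_(k < n) (`|n%:R^-1| * M) * (1 - M)^-1)).
    rewrite sumr_const card_ord -[_ *+ n]mulr_natl gtr0_norm ?invr_gt0//.
    have -> : n%:R * (n%:R^-1 * M * (1 - M)^-1) = M / (1 - M) by field; rewrite !gt_eqF.
    exact: lexx.
  apply: norm_le_sum => k _; apply: norm_leM => //; first exact: norm_leZ.
  by apply: norm_le_inv => //; apply: step; exact: ltnW.
move=> x hx; have gM := norm_le_eval hg hx.
have apos k : (k <= n)%N -> 1 - M <= a k x.
  by move=> kn; have := norm_le_eval (step _ kn) hx; rewrite ler_norml; lra.
have an : a n x = 1 + g x by rewrite /a divff ?mul1r// gt_eqF.
have a0 : a 0%N x = 1 by rewrite /a mul0r mul0r addr0.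
have -> : ln (1 + g x) = \sum_(k < n) (ln (a k.+1 x) - ln (a k x)).
  rewrite -(big_mkord xpredT (fun k => ln (a k.+1 x) - ln (a k x))).
  by rewrite telescope_sumr// an a0 ln1 subr0.
rewrite -sumrB; apply: (le_trans (ler_norm_sum _ _ _)).
apply: (@le_trans _ _ (\sum_(k < n) (M / n%:R) ^+ 2 / (1 - M) ^+ 2)).
  apply: ler_sum => k _.
  have d : a k.+1 x - a k x = n%:R^-1 * g x.
    by rewrite /a -[k.+1%:R]natr1; field; rewrite gt_eqF.
  have p1 := apos k (ltnW (ltn_ord k)); have p2 := apos k.+1 (ltn_ord k).
  have q1 := lt_le_trans h p1; have q2 := lt_le_trans h p2.
  have := ln_increment_le q1 q2; rewrite d => /le_trans; apply.
  apply: ler_pM; [exact: sqr_ge0|by rewrite invr_ge0 mulr_ge0// ltW| |].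
    rewrite -real_normK ?num_real// lerXn2r ?nnegrE ?divr_ge0// normrM mulrC.
    by rewrite (gtr0_norm (x := _^-1)) ?invr_gt0// ler_wpM2r// invr_ge0 ltW.
  have q3 : 0 < a k x * a k.+1 x by rewrite mulr_gt0.
  by rewrite lef_pV2 ?posrE ?exprn_gt0// expr2; apply: ler_pM => //; exact: ltW.
rewrite sumr_const card_ord -[_ *+ n]mulr_natl.
have -> : n%:R * ((M / n%:R) ^+ 2 / (1 - M) ^+ 2) = M ^+ 2 / (1 - M) ^+ 2 / n%:R.
  by field; rewrite !gt_eqF.
rewrite ler_pdivrMr//; apply: (@le_trans _ _ (eta * K)).
  have -> : eta * K = 1 / (1 - M) ^+ 2 by rewrite /K; field; rewrite !gt_eqF.
  by rewrite ler_wpM2r ?invr_ge0 ?sqr_ge0// exprn_ile1// ltW.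
by rewrite ler_wpM2l// ltW.
Qed.

(** If [t * L] is at most 1/2, then [ln f - ln g] is the logarithm of [1 + (f - g) / g] and has norm
    at most [2 * L * t]. Otherwise the crude bound [2 * M] is at most [4 * M * L * t]. The sum of
    the two constants makes the estimate free of any smallness assumption on [t]. *)
Lemma norm_le_lnB L M t f g :
  (forall x, cube x0 r x -> 0 < f x) -> (forall x, cube x0 r x -> 0 < g x) ->
  norm_le x0 r L (fun x => (g x)^-1) -> norm_le x0 r t (fun x => f x - g x) ->
  norm_le x0 r M (fun x => ln (f x)) -> norm_le x0 r M (fun x => ln (g x)) ->
  norm_le x0 r ((2 * L + 4 * M * L) * t) (fun x => ln (f x) - ln (g x)).
Proof.
move=> f0 g0 gL fgt fM gM.
have L0 := norm_le_ge0 r0 gL; have t0 := norm_le_ge0 r0 fgt.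
have M0 := norm_le_ge0 r0 fM.
have Lt0 := mulr_ge0 t0 L0; have MLt0 := mulr_ge0 M0 Lt0.
have [Lt|Lt] := leP (t * L) (1 / 2).
  apply: (@norm_leW _ _ _ _ (t * L / (1 - t * L))).
    rewrite ler_pdivrMr; last by lra.
    have : 0 <= (t * L) * (1 - 2 * (t * L)) by rewrite mulr_ge0//; lra.
    have : 0 <= (M * (t * L)) * (1 - t * L) by rewrite mulr_ge0//; lra.
    nra.
  have : norm_le x0 r (t * L / (1 - t * L)) (fun x => ln (1 + (f x - g x) * (g x)^-1)).
    by apply: norm_le_ln1D; [lra|exact: norm_leM].
  apply: norm_le_ext => x hx.
  have -> : 1 + (f x - g x) / g x = f x / g x by field; rewrite gt_eqF ?g0.
  by rewrite ln_div// posrE ?f0 ?g0.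
apply: norm_leW (norm_leB r0 fM gM).
have : 0 <= M * (t * L - 1 / 2) by rewrite mulr_ge0//; lra.
nra.
Qed.

End Logarithm.

(** * Finite sums of terms, coefficients and tails *)

Section PowerSeries.
Context {R : realType} {m : nat}.
Implicit Types (c : {ffun 'I_m -> nat} -> R) (J : {fset {ffun 'I_m -> nat}}).

(** A finite exhaustion of the multi-indices: the boxes serve as thresholds in the net of finite
    sets and as truncations of a series. *)
Definition box (N : nat) : {fset {ffun 'I_m -> nat}} :=
  seq_fset tt [seq [ffun i => nat_of_ord (g i)] | g : {ffun 'I_m -> 'I_N}].

Lemma box_mdegree N a : a \notin box N -> (N <= mdegree a)%N.
Proof.
move=> aN; have [i Ni] : exists i, (N <= a i)%N.
  apply: contrapT => /forallNP h; move/negP: aN; apply.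
  have hlt i : (a i < N)%N by rewrite ltnNge; apply/negP; exact: h.
  rewrite seq_fsetE; apply/mapP; exists [ffun i => Ordinal (hlt i)].
    by rewrite mem_enum.
  by apply/ffunP => i; rewrite !ffunE.
by apply: (leq_trans Ni); rewrite /mdegree (bigD1 i)//= leq_addr.
Qed.

Lemma mdegree_box N a : (mdegree a < N)%N -> a \in box N.
Proof.
by move=> aN; apply: contraLR aN => /box_mdegree; rewrite -leqNgt.
Qed.

Lemma partial_sumE (x : {ffun 'I_m -> nat} -> R) J :
  summability.partial_sum x J = \sum_(a <- J) x a.
Proof. by rewrite /summability.partial_sum big_seq_fsetE. Qed.

Lemma cvg_sum_seq (T : Type) (F : set_system T) (I : Type) (s : seq I)
    (f : I -> T -> R) (l : I -> R) : Filter F ->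
  (forall i, f i x @[x --> F] --> l i) ->
  \sum_(i <- s) f i x @[x --> F] --> \sum_(i <- s) l i.
Proof.
move=> FF hf; elim: s => [|i s IH].
  rewrite big_nil; under eq_fun do rewrite big_nil; exact: cvg_cst.
by rewrite big_cons; under eq_fun do rewrite big_cons; exact: cvgD.
Qed.

Lemma ultra_fmap (T U : Type) (f : T -> U) (F : set_system T) :
  UltraFilter F -> UltraFilter (f @ F).
Proof.
move=> FU; have PF : ProperFilter F := ultra_proper.
split; first exact: fmap_proper_filter.
move=> G PG FG; apply/seteqP; split => A; last exact: FG.
move=> GA; have [//|nA] := in_ultra_setVsetC (f @^-1` A) FU.
exfalso; apply: (@filter_not_empty _ G _).
rewrite -(setICr A); apply: filterI => //; exact: FG.
Qed.

Lemma sum_coef (w : {ffun 'I_m -> nat} -> R) (p : seq (R * {ffun 'I_m -> nat})) J :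
  \sum_(a <- J) poly_coef p a * w a = \sum_(t <- p | t.2 \in J) t.1 * w t.2.
Proof.
under eq_bigr do rewrite /poly_coef mulr_suml.
rewrite (exchange_big_dep xpredT)//= [RHS]big_mkcond/=; apply: eq_bigr => t _.
rewrite (eq_bigl (pred1 t.2)) => [|a]; last exact: eq_sym.
rewrite -big_filter; case: ifPn => tJ.
  by rewrite filter_pred1_uniq ?fset_uniq// big_seq1.
rewrite (eq_in_filter (a2 := pred0)) ?filter_pred0 ?big_nil// => a aJ /=.
by apply: contraNF tJ => /eqP <-.
Qed.

Lemma poly_coef_le (r : R) p (a : {ffun 'I_m -> nat}) :
  0 < r -> `|poly_coef p a| <= poly_norm r p / r ^+ mdegree a.
Proof.
move=> r0; rewrite ler_pdivlMr ?exprn_gt0//.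
have rX k : 0 <= r ^+ k by rewrite exprn_ge0// ltW.
apply: (@le_trans _ _ (\sum_(t <- p | t.2 == a) `|t.1| * r ^+ mdegree t.2)).
  rewrite (eq_bigr (fun t => `|t.1| * r ^+ mdegree a)) => [|t /eqP -> //].
  by rewrite -mulr_suml ler_wpM2r// ler_norm_sum.
rewrite /poly_norm [leRHS](bigID (fun t => t.2 == a))/= lerDl.
by apply: sumr_ge0 => t _; rewrite mulr_ge0.
Qed.

(** Shrinking the cube by the factor [s] multiplies the bound of a monomial of degree [k] by
    [s ^+ k], which is at most [s ^+ N] in the tail. *)
Lemma tail_le (r s : R) (h : 'rV[R]_m) (p : seq (R * {ffun 'I_m -> nat})) N
    (Q : pred _) : 0 <= r -> 0 <= s <= 1 -> (forall i, `|h 0 i| <= s * r) ->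
  (forall a, Q a -> (N <= mdegree a)%N) ->
  `|\sum_(t <- p | Q t.2) t.1 * \prod_(i < m) h 0 i ^+ t.2 i|
    <= s ^+ N * poly_norm r p.
Proof.
move=> r0 /andP[s0 s1] hr QN; apply: (le_trans (ler_norm_sum _ _ _)).
rewrite /poly_norm mulr_sumr [leRHS](bigID (fun t => Q t.2))/=.
rewrite -[leLHS]addr0 lerD//; last first.
  by apply: sumr_ge0 => t _; rewrite !mulr_ge0// exprn_ge0.
apply: ler_sum => t /QN Nt; rewrite normrM mulrCA ler_wpM2l//.
apply: (le_trans (monomial_le _ hr)); rewrite exprMn ler_wpM2r ?exprn_ge0//.
by rewrite ler_wiXn2l.
Qed.

End PowerSeries.

#[local] Existing Instance summability.totally_filter.

(** * Bounded norm versus convergent power series *)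

Section Analytic.
Context {R : realType} {m : nat} (x0 : 'rV[R]_m).

Lemma near_cubeP (P : set 'rV[R]_m) :
  (\forall x \near x0, P x) <-> exists2 r, 0 < r & cube x0 r `<=` P.
Proof.
split=> [/nbhs_ballP[e /= e0 eP]|[r r0 rP]].
  exists (e / 2) => [|x hx]; first by rewrite divr_gt0.
  apply: eP; split=> // i j; rewrite (ord1 i) /ball/= distrC.
  by apply: (le_lt_trans (hx j)); rewrite ltr_pdivrMr// ltr_pMr// ltr1n.
apply/nbhs_ballP; exists r => //= x hx; apply: rP => i.
by have [_ /(_ 0 i)] := hx; rewrite /ball/= distrC => /ltW.
Qed.

(* The coefficients are limits, along an ultrafilter, of those of approximating
   polynomials of bounded norm. *)
Lemma norm_le_power_series (r M : R) f : 0 < r -> norm_le x0 r M f ->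
  exists c, \forall x \near x0, power_series_sums c (x - x0) (f x).
Proof.
move=> r0 hf; have rge0 := ltW r0.
have M0 := norm_le_ge0 rge0 hf.
have /choice[p hp] : forall n : nat, exists p, poly_norm r p <= M /\
    forall x, cube x0 r x -> `|f x - poly_eval p (x - x0)| <= n.+1%:R^-1.
  by move=> n; have [|p pM fp] := hf n.+1%:R^-1; [rewrite invr_gt0|exists p].
have [U [UU oU]] := ultraFilterLemma (F := \oo) _.
have PU : ProperFilter U := ultra_proper.
have /choice[c hc] : forall a : {ffun 'I_m -> nat}, exists c : R,
    poly_coef (p n) a @[n --> U] --> c.
  (* The coefficients of all the approximating polynomials lie in the compact segment from [- K] to
     [K], where an ultrafilter converges. *)
  move=> a; pose K := M / r ^+ mdegree a.
  have := @segment_compact R (- K) K; rewrite compact_ultra.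
  move=> /(_ _ (ultra_fmap (fun n => poly_coef (p n) a) UU))[].
    apply: (@filterE _ U) => n /=; rewrite in_itv/= -ler_norml.
    apply: (le_trans (poly_coef_le _ _ r0)).
    by rewrite ler_wpM2r ?invr_ge0 ?exprn_ge0//; case: (hp n).
  by move=> y [_ hy]; exists y.
(* On the half-size cube the terms outside [box N] contribute at most [2^-1 ^+ N * M], uniformly in
   [n]. For a fixed finite [J] containing the box this bound survives the limit along [U]. *)
exists c; apply/near_cubeP; exists (2^-1 * r) => [|x hx].
  by rewrite mulr_gt0// invr_gt0.
have hx2 i : `|(x - x0) 0 i| <= 2^-1 * r by rewrite !mxE; exact: hx.
have hxr : cube x0 r x.
  by move=> i; apply: (le_trans (hx i)); rewrite ler_piMl// invf_le1// ler1n.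
apply/cvgrPdist_le => eta eta0.
have [||N hN] := @expr_small R 2^-1 (eta / (M + 1)).
- by rewrite invr_ge0 ler0n invf_lt1// ltr1n.
- by rewrite divr_gt0// ltr_wpDl.
exists (box N) => // J /= /fsubsetP NJ; rewrite partial_sumE.
have hlim : `|f x - \sum_(a <- J) poly_coef (p n) a * \prod_(i < m) (x - x0) 0 i ^+ a i|
    @[n --> U] --> `|f x - \sum_(a <- J) power_series_term c (x - x0) a|.
  apply: cvg_norm; apply: cvgB; first exact: cvg_cst.
  by apply: cvg_sum_seq => a; apply: cvgM; [exact: hc|exact: cvg_cst].
have harm : n.+1%:R^-1 + 2^-1 ^+ N * M @[n --> U] --> 0 + 2^-1 ^+ N * M.
  apply: cvgD; last exact: cvg_cst.
  by apply: cvg_trans (@cvg_harmonic R); exact: cvg_app.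
apply: (@le_trans _ _ (0 + 2^-1 ^+ N * M)).
  apply: ler_cvg_to hlim harm _; apply: filterE => n.
  have [pM fp] := hp n; rewrite sum_coef.
  rewrite -(subrKA (poly_eval (p n) (x - x0))).
  apply: (le_trans (ler_normD _ _)); apply: lerD; first exact: fp.
  rewrite /poly_eval (bigID (fun t => t.2 \in J))/= [X in X - _]addrC addrK.
  apply: (le_trans (tail_le (r := r) (s := 2^-1) (N := N) (p n)
    (Q := fun a => a \notin J) _ _ hx2 _)) => //.
  - by rewrite invr_ge0 ler0n invf_le1// ler1n.
  - by move=> a aJ; apply: box_mdegree; apply: contra aJ; exact: NJ.
  - by rewrite ler_wpM2l// exprn_ge0// invr_ge0.
rewrite add0r (le_trans (ler_wpM2r M0 hN))// mulrAC.
by rewrite ler_pdivrMr ?ltr_wpDl// ler_wpM2l ?lerDl// ltW.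
Qed.

(** All finite partial sums are bounded by [C]: adding [J0] to the index set brings the sum within 1
    of [l], and taking the added terms away costs at most their absolute sum. Splitting [J] by the
    sign of the terms then bounds the absolute sums by [C + C]. *)
Lemma power_series_abs_bound (c : {ffun 'I_m -> nat} -> R) (h : 'rV[R]_m) l :
  power_series_sums c h l ->
  exists M, forall J : {fset {ffun 'I_m -> nat}},
    \sum_(a <- J) `|power_series_term c h a| <= M.
Proof.
move=> /cvgrPdist_le/(_ _ ltr01)[J0 _ hJ0].
pose C := `|l| + 1 + \sum_(a <- J0) `|power_series_term c h a|.
have hC (K : {fset {ffun 'I_m -> nat}}) :
    `|\sum_(a <- K) power_series_term c h a| <= C.
  have := hJ0 (K `|` J0)%fset (fsubsetUr _ _).
  rewrite /= partial_sumE (big_fsetID _ (fun x => x \in K)).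
  have -> : [fset x in (K `|` J0)%fset | x \in K]%fset = K.
    by apply/fsetP => a; rewrite !inE; case: (a \in K) => //=; rewrite ?andbF ?andbT.
  have -> : [fset x in (K `|` J0)%fset | x \notin K]%fset = [fset x in J0 | x \notin K]%fset.
    by apply/fsetP => a; rewrite !inE; case: (a \in K) => //=; rewrite ?andbF ?andbT.
  rewrite -big_fset_condE /=.
  set S := \sum_(a <- K) _; set T := \sum_(a <- J0 | _) _.
  have : `|T| <= \sum_(a <- J0) `|power_series_term c h a|.
    apply: (le_trans (ler_norm_sum _ _ _)).
    rewrite [leRHS](bigID (fun a => a \notin K))/= lerDl.
    exact: sumr_ge0.
  rewrite /C; have := ler_norm l; have := lerNnormlW (lexx `|l|).
  rewrite !ler_norml; lra.
exists (C + C) => J.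
rewrite (bigID (fun a => 0 <= power_series_term c h a))/=.
apply: lerD.
  rewrite (eq_bigr (power_series_term c h)) => [|a a0]; last exact: ger0_norm.
  by rewrite big_fset_condE; apply: (le_trans (ler_norm _)); exact: hC.
rewrite (eq_bigr (fun a => - power_series_term c h a)) => [|a a0]; last first.
  by rewrite ltr0_norm// ltNge.
by rewrite sumrN big_fset_condE (le_trans (ler_norm _))// normrN hC.
Qed.

(** The passage from analyticity to the norm: on small cubes the nonconstant part of a convergent
    power series has small norm. *)
Lemma power_series_norm_le (c : {ffun 'I_m -> nat} -> R) (f : 'rV[R]_m -> R) :
  (\forall x \near x0, power_series_sums c (x - x0) (f x)) ->
  forall delta : R, 0 < delta ->
    \forall r \near 0^'+, norm_le x0 r delta (fun x => f x - f x0).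
Proof.
move=> /near_cubeP[r1 r10 hf] delta delta0.
(* At this corner of the cube the monomial of index [a] has value [r1 ^+ mdegree a], so that
   absolute convergence there bounds the weighted sums of the coefficients. *)
have hr1 : cube x0 r1 (x0 + const_mx r1).
  by move=> i; rewrite !mxE addrAC subrr add0r gtr0_norm.
have [M0 hM0] := power_series_abs_bound (hf _ hr1).
have hM (J : {fset {ffun 'I_m -> nat}}) : \sum_(a <- J) `|c a| * r1 ^+ mdegree a <= `|M0| + 1.
  apply: (@le_trans _ _ M0); last by rewrite ler_wpDr ?ler_norm.
  apply: le_trans (hM0 J); rewrite le_eqVlt; apply/orP; left; apply/eqP.
  apply: eq_bigr => a _; rewrite /power_series_term normrM; congr (_ * _).
  rewrite normr_prod /mdegree -prodrXr; apply: eq_bigr => i _.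
  by rewrite !mxE addrAC subrr add0r normrX gtr0_norm.
move: (`|M0| + 1) (ltr_wpDl (normr_ge0 M0) ltr01) hM => M Mgt0 hM.
(* From radius [r1] to [s * r1] every monomial of positive degree shrinks by at least [s], which
   brings the nonconstant part below [delta / 2]; [s <= 2^-1] gives geometric tails. *)
pose s := Num.min 2^-1 (delta / 2 / M).
have s0 : 0 < s by rewrite lt_min invr_gt0 ltr0n/= !divr_gt0.
have s2 : s <= 2^-1 by rewrite ge_min lexx.
have sM : s * M <= delta / 2 by rewrite -ler_pdivlMr// ge_min lexx orbT.
near=> r.
have r0 : 0 < r by near: r; exact: nbhs_right_gt.
have rs : r <= s * r1 by near: r; apply: nbhs_right_le; exact: mulr_gt0.
have h2 : 2^-1 < 1 :> R by rewrite invf_lt1// ltr1n.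
have ss : 0 <= s <= 1 by rewrite ltW//= (le_trans s2)// ltW.
have rr1 : r <= r1 by apply: (le_trans rs); rewrite ler_piMl ?ltW//; lra.
have main : norm_le x0 r (delta / 2) (fun x => f x - c [ffun=> 0%N]).
  move=> eta eta0.
  have [||N hN] := @expr_small R 2^-1 (eta / 2 / M).
  - by rewrite invr_ge0 ler0n.
  - by rewrite !divr_gt0.
  pose z : {ffun 'I_m -> nat} := [ffun=> 0%N].
  have z0 : mdegree z = 0%N by rewrite /mdegree big1// => i _; rewrite ffunE.
  have zN : z \in box N.+1 by apply: mdegree_box; rewrite z0.
  pose pt (J : {fset {ffun 'I_m -> nat}}) := [seq (c a, a) | a <- J].
  have hpt (J : {fset {ffun 'I_m -> nat}}) : poly_norm r1 (pt J) <= M.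
    by rewrite /poly_norm big_map; exact: hM.
  have hterm x (J : {fset {ffun 'I_m -> nat}}) :
      \sum_(a <- J) power_series_term c (x - x0) a = poly_eval (pt J) (x - x0).
    by rewrite /poly_eval big_map.
  exists (pt (box N.+1 `\ z)%fset).
    apply: le_trans sM; apply: (@le_trans _ _ (s * poly_norm r1 (pt (box N.+1 `\ z)%fset))).
      rewrite /poly_norm !big_map mulr_sumr big_seq [leRHS]big_seq.
      apply: ler_sum => a; rewrite in_fsetD1 => /andP[az _] /=.
      rewrite mulrCA ler_wpM2l//.
      have a0 : (0 < mdegree a)%N.
        rewrite lt0n; apply: contra az => /eqP/eqP; rewrite sum_nat_eq0 => /forallP az.
        by apply/eqP/ffunP => i; rewrite ffunE; apply/eqP; exact: az.
      apply: (@le_trans _ _ ((s * r1) ^+ mdegree a)).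
        by rewrite lerXn2r ?nnegrE ?mulr_ge0// ltW.
      rewrite exprMn ler_wpM2r ?exprn_ge0 ?(ltW r10)//.
      rewrite -[leRHS]expr1; case/andP: ss => ? ?; exact: ler_wiXn2l.
    by rewrite ler_wpM2l// ltW.
  move=> x hx.
  have hx1 : cube x0 r1 x by move=> i; apply: le_trans rr1.
  have hxs i : `|(x - x0) 0 i| <= s * r1 by rewrite !mxE; exact: le_trans rs.
  have /cvgrPdist_le/(_ _ (divr_gt0 eta0 (ltr0n R 2)))[J0 _ hJ0] := hf _ hx1.
  pose J := (box N.+1 `|` J0)%fset.
  have := hJ0 J (fsubsetUr _ _); rewrite /= partial_sumE hterm => hJ.
  have e1 : poly_eval (pt (box N.+1)) (x - x0) =
      c z + poly_eval (pt (box N.+1 `\ z)%fset) (x - x0).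
    rewrite -!hterm (big_fsetD1 z)//=; congr (_ + _).
    by rewrite /power_series_term big1 ?mulr1// => i _; rewrite ffunE expr0.
  have e2 : `|poly_eval (pt J) (x - x0) - poly_eval (pt (box N.+1)) (x - x0)| <= eta / 2.
    rewrite -!hterm (big_fsetID _ (fun a => a \in box N.+1))/=.
    have -> : [fset a in J | a \in box N.+1]%fset = box N.+1.
      by apply/fsetP => a; rewrite !inE; case: (a \in box _) => //=; rewrite ?andbF ?andbT.
    rewrite (addrC (\sum_(a <- box N.+1) _)) addrK -big_fset_condE.
    have := tail_le (pt J) (N := N.+1) (Q := fun a => a \notin box N.+1)
      (ltW r10) ss hxs (fun a => @box_mdegree m N.+1 a).
    rewrite big_map /= => /le_trans; apply.
    apply: (@le_trans _ _ (2^-1 ^+ N * M)).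
      apply: ler_pM => //; [by rewrite exprn_ge0// ltW|by rewrite poly_norm_ge0// ltW|].
      apply: (@le_trans _ _ (s ^+ N)).
        by case/andP: ss => ? ?; exact: ler_wiXn2l.
      by rewrite lerXn2r ?nnegrE// ?invr_ge0// ltW.
    by rewrite -ler_pdivlMr.
  have -> : f x - c z - poly_eval (pt (box N.+1 `\ z)%fset) (x - x0) =
    (f x - poly_eval (pt J) (x - x0)) +
    (poly_eval (pt J) (x - x0) - poly_eval (pt (box N.+1)) (x - x0)).
    by rewrite e1; ring.
  rewrite (splitr eta); apply: (le_trans (ler_normD _ _)).
  by apply: lerD.
have r0' := ltW r0.
(* Evaluation at the center bounds [f x0 - c 0] by [delta / 2]; the other half of [delta] pays for
   exchanging the two constants. *)
have hc := norm_le_eval main (cube_center x0 r0').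
rewrite (splitr delta).
apply: norm_le_ext (norm_leB r0' main
  (norm_leW hc (norm_le_cst x0 r (f x0 - c [ffun=> 0%N])))).
by move=> x _; rewrite opprB addrA subrK.
Unshelve. all: by end_near.
Qed.

End Analytic.

(** * Averaging *)

Section Averaging.
Context {R : realType} {m : nat} (x0 : 'rV[R]_m) (r : R) (B : nat).
Hypothesis r0 : 0 <= r.
Implicit Types (p : 'I_B -> R) (P v : 'I_B -> 'rV[R]_m -> R).

Lemma sum_const_ord (M : R) : \sum_(j < B) M = B%:R * M.
Proof. by rewrite sumr_const card_ord mulr_natl. Qed.

(* Doeblin's condition [kappa p' <= p] lets a part [kappa] of the masses of [p]
   and [p'] be coupled on the diagonal. *)
Lemma norm_le_doeblin p p' kappa v omega :
  (forall j, 0 <= p' j) -> (forall j, kappa * p' j <= p j) ->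
  \sum_j p j = 1 -> \sum_j p' j = 1 ->
  (forall j l, norm_le x0 r omega (fun x => v j x - v l x)) ->
  norm_le x0 r ((1 - kappa) * omega)
    (fun x => \sum_j p j * v j x - \sum_j p' j * v j x).
Proof.
move=> p'0 pp' sp sp' hv.
pose d j := p j - kappa * p' j.
have d0 j : 0 <= d j by rewrite subr_ge0.
have sd : \sum_j d j = 1 - kappa by rewrite sumrB -mulr_sumr sp sp' mulr1.
(* Once the common part [kappa * p'] is removed, the leftovers are [d] and [(1 - kappa) * p']; they
   are coupled independently, with weights [d j * p' l]. *)
have key : norm_le x0 r (\sum_j \sum_l (`|d j * p' l| * omega))
    (fun x => \sum_j \sum_l (d j * p' l) * (v j x - v l x)).
  by apply: norm_le_sum => j _; apply: norm_le_sum => l _; apply: norm_leZ.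
have eM : \sum_j \sum_l (`|d j * p' l| * omega) = (1 - kappa) * omega.
  rewrite -sd mulr_suml; apply: eq_bigr => j _.
  rewrite -mulr_suml; congr (_ * _); rewrite -[RHS]mulr1 -sp' mulr_sumr.
  by apply: eq_bigr => l _; rewrite ger0_norm// mulr_ge0.
rewrite -eM; apply: norm_le_ext key => x _.
have -> : \sum_j p j * v j x =
    \sum_j d j * v j x + kappa * \sum_j p' j * v j x.
  by rewrite mulr_sumr -big_split/=; apply: eq_bigr => j _; rewrite /d; ring.
have -> : \sum_j \sum_l d j * p' l * (v j x - v l x) =
    \sum_j d j * v j x - (\sum_j d j) * \sum_l p' l * v l x.
  rewrite mulr_suml -sumrB; apply: eq_bigr => j _.
  rewrite -[X in X - _]mulr1 -sp' !mulr_sumr -sumrB.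
  by apply: eq_bigr => l _; ring.
by rewrite sd; ring.
Qed.

Lemma norm_le_average_sub p P tau v omega l :
  (forall j, norm_le x0 r tau (fun x => P j x - p j)) ->
  (forall j, norm_le x0 r omega (fun x => v j x - v l x)) ->
  norm_le x0 r (B%:R * tau * omega)
    (fun x => \sum_j (P j x - p j) * (v j x - v l x)).
Proof.
move=> hP hv; rewrite -mulrA -sum_const_ord.
by apply: norm_le_sum => j _; exact: norm_leM.
Qed.

(** Both weights have total mass 1, so recentering [v] at a reference index changes nothing. This is
    why the error of replacing [p] by [P] involves only the oscillation of [v]. *)
Lemma average_subE p P v l x : \sum_j p j = 1 -> \sum_j P j x = 1 ->
  \sum_j (P j x - p j) * (v j x - v l x) =
  \sum_j P j x * v j x - \sum_j p j * v j x.
Proof.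
move=> sp sP; rewrite -sumrB.
rewrite (eq_bigr (fun j => (P j x * v j x - p j * v j x) - (P j x - p j) * v l x)).
  rewrite [LHS]sumrB -[X in _ - X = _]mulr_suml (sumrB _ _ (P ^~ x)) sp sP.
  by rewrite subrr mul0r subr0.
by move=> j _; ring.
Qed.

(** Doeblin contraction for perturbed weights: passing from [P] to [p] and from [P'] to [p'] costs
    [B%:R * tau * omega] each. *)
Lemma norm_le_average_osc p p' P P' kappa tau v omega :
  (forall j, 0 <= p' j) -> (forall j, kappa * p' j <= p j) ->
  \sum_j p j = 1 -> \sum_j p' j = 1 ->
  (forall x, cube x0 r x -> \sum_j P j x = 1) ->
  (forall x, cube x0 r x -> \sum_j P' j x = 1) ->
  (forall j, norm_le x0 r tau (fun x => P j x - p j)) ->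
  (forall j, norm_le x0 r tau (fun x => P' j x - p' j)) ->
  (forall j l, norm_le x0 r omega (fun x => v j x - v l x)) ->
  norm_le x0 r ((1 - kappa + 2 * (B%:R * tau)) * omega)
    (fun x => \sum_j P j x * v j x - \sum_j P' j x * v j x).
Proof.
move=> p'0 pp' sp sp' sP sP' hP hP' hv.
have [l _|noB] := pickP 'I_B; last first.
  exfalso; move: sp; rewrite big_pred0 => [/eqP|j]; last by have := noB j.
  by rewrite eq_sym oner_eq0.
have h1 := norm_le_average_sub hP (hv ^~ l).
have h2 := norm_le_average_sub hP' (hv ^~ l).
have h3 := norm_le_doeblin p'0 pp' sp sp' hv.
have -> : (1 - kappa + 2 * (B%:R * tau)) * omega =
  (1 - kappa) * omega + (B%:R * tau * omega + B%:R * tau * omega) by ring.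
apply: norm_le_ext (norm_leD h3 (norm_leB r0 h1 h2)) => x hx.
by rewrite !average_subE ?sP ?sP'//; ring.
Qed.

Lemma norm_le_average_dist p P tau v omega l :
  (forall j, 0 <= p j) -> \sum_j p j = 1 ->
  (forall x, cube x0 r x -> \sum_j P j x = 1) ->
  (forall j, norm_le x0 r tau (fun x => P j x - p j)) ->
  (forall j, norm_le x0 r omega (fun x => v j x - v l x)) ->
  norm_le x0 r ((1 + B%:R * tau) * omega)
    (fun x => \sum_j P j x * v j x - v l x).
Proof.
move=> p0 sp sP hP hv.
have h1 : norm_le x0 r (\sum_j `|p j| * omega) (fun x => \sum_j p j * (v j x - v l x)).
  by apply: norm_le_sum => j _; exact: norm_leZ.
have -> : (1 + B%:R * tau) * omega = \sum_j `|p j| * omega + B%:R * tau * omega.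
  by rewrite -mulr_suml (eq_bigr p) ?sp => [|j _]; [ring|exact: ger0_norm].
apply: norm_le_ext (norm_leD h1 (norm_le_average_sub hP hv)) => x hx.
rewrite average_subE ?sP//.
rewrite (eq_bigr (fun j => p j * v j x - p j * v l x)) => [|j _]; last by ring.
by rewrite sumrB -[X in _ - X]mulr_suml sp; ring.
Qed.

(** The geometric increments bound by telescoping both the norms of all [f n] and their uniform
    distance to the limit, so [norm_le_lim] applies. *)
Lemma norm_le_geometric_lim (f : nat -> 'rV[R]_m -> R) M C psi :
  0 <= psi < 1 -> norm_le x0 r M (f 0%N) ->
  (forall n, norm_le x0 r (C * psi ^+ n) (fun x => f n.+1 x - f n x)) ->
  exists2 h, norm_le x0 r (M + C / (1 - psi)) h &
    forall x, cube x0 r x -> f n x @[n --> \oo] --> h x.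
Proof.
move=> hpsi hM hC; have /andP[psi0 psi1] := hpsi.
have C0 : 0 <= C by have := norm_le_ge0 r0 (hC 0%N); rewrite expr0 mulr1.
have fM n : norm_le x0 r (M + C / (1 - psi)) (f n).
  have : norm_le x0 r (M + \sum_(k < n) C * psi ^+ k) (f n).
    elim: n => [|n IH]; first by rewrite big_ord0 addr0.
    rewrite big_ord_recr/= addrA; apply: norm_le_ext (norm_leD IH (hC n)) => x _.
    by rewrite addrC subrK.
  apply: norm_leW; rewrite lerD2l -mulr_sumr ler_wpM2l//.
  exact: geometric_sum_le.
have dist x n k : cube x0 r x ->
    `|f (n + k)%N x - f n x| <= C * psi ^+ n / (1 - psi).
  move=> hx; have : `|f (n + k)%N x - f n x| <= C * psi ^+ n * \sum_(j < k) psi ^+ j.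
    elim: k => [|k IH]; first by rewrite addn0 subrr normr0 big_ord0 mulr0.
    rewrite addnS -(subrKA (f (n + k)%N x)) big_ord_recr/= mulrDr addrC.
    rewrite (le_trans (ler_normD _ _))// lerD//.
    by have := norm_le_eval (hC (n + k)%N) hx; rewrite exprD mulrA.
  move/le_trans; apply; apply: ler_wpM2l; first by rewrite mulr_ge0// exprn_ge0.
  exact: geometric_sum_le.
have small (eta : R) : 0 < eta -> exists n, C * psi ^+ n / (1 - psi) <= eta.
  move=> eta0; have p1 : 0 < 1 - psi by lra.
  have K0 : 0 < C / (1 - psi) + 1 by rewrite ltr_wpDl// divr_ge0// ltW.
  have [n hn] := expr_small hpsi (divr_gt0 eta0 K0).
  exists n; rewrite mulrAC; apply: le_trans (ler_wpM2l _ hn) _.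
    by rewrite divr_ge0// ltW.
  by rewrite mulrCA ler_piMr ?(ltW eta0)// ler_pdivrMr// mul1r lerDl.
have cv x : cube x0 r x -> cvgn (fun n => f n x).
  move=> hx; apply/cauchy_cvgP/cauchy_exP => eta eta0.
  have [n hn] := small _ (divr_gt0 eta0 (ltr0n R 2)).
  exists (f n x), n => // k /= nk; rewrite /ball/= distrC -(subnKC nk).
  apply: (le_lt_trans (dist _ _ _ hx)); apply: (le_lt_trans hn).
  by rewrite ltr_pdivrMr// ltr_pMr// ltr1n.
exists (fun x => limn (fun n => f n x)); last by move=> x /cv.
apply: norm_le_lim => eta /small[n hn]; exists (f n) => // x hx.
apply: le_trans hn.
have lim1 : `|f k x - f n x| @[k --> \oo] --> `|limn (fun n => f n x) - f n x|.
  by apply: cvg_norm; apply: cvgB; [exact: cv|exact: cvg_cst].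
apply: (ler_cvg_to lim1 (cvg_cst _)).
by exists n => // k /= nk; rewrite -(subnKC nk); exact: dist.
Qed.

End Averaging.

(** * Masses of words *)

Section Words.
Context {R : realType} {A B : nat} (Phi : 'I_B -> 'I_A).
Implicit Types (Q : 'M[R]_B) (w : seq 'I_A) (a : 'I_A).

(* Probability that the chain started at [i] then emits the word [w]. *)
Fixpoint word_mass Q w (i : 'I_B) : R :=
  if w is a :: w' then \sum_(j | Phi j == a) Q i j * word_mass Q w' j else 1.

(* Probability that the chain started at [i] next visits [j], given that it
   emits [a :: w]. *)
Definition word_kernel Q a w (i j : 'I_B) : R :=
  (Phi j == a)%:R * (Q i j * (word_mass Q w j / word_mass Q (a :: w) i)).

(* Probability that the chain started at [i] emits the letter [a], given that
   it first emits [w]. *)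
Definition next_mass Q w a (i : 'I_B) : R :=
  word_mass Q (rcons w a) i / word_mass Q w i.

Lemma word_massE Q a w i :
  word_mass Q (a :: w) i = \sum_j (Phi j == a)%:R * (Q i j * word_mass Q w j).
Proof.
by rewrite /= big_mkcond/=; apply: eq_bigr => j _; case: eqP => _; rewrite ?mul1r ?mul0r.
Qed.

Lemma word_kernel_sum1 Q a w i : word_mass Q (a :: w) i != 0 ->
  \sum_j word_kernel Q a w i j = 1.
Proof.
move=> nz; rewrite -(divff nz) [X in _ = X / _]word_massE mulr_suml.
by apply: eq_bigr => j _; rewrite /word_kernel !mulrA.
Qed.

(** Lengthening the past at its remote end is an averaging. The forgetting of the initial state and
    the lower bounds on [next_mass] rest on this identity. *)
Lemma word_kernel_next Q b w a i : (forall j, word_mass Q w j != 0) ->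
  next_mass Q (b :: w) a i =
    \sum_j word_kernel Q b w i j * next_mass Q w a j.
Proof.
move=> nz; rewrite {1}/next_mass rcons_cons word_massE mulr_suml.
apply: eq_bigr => j _; rewrite /word_kernel /next_mass.
move: (word_mass Q (b :: w) i) => /= y; rewrite -!mulrA; congr (_ * (_ * _)).
by rewrite mulrC [RHS]mulrCA (mulrCA (word_mass Q w j)) divff// mulr1.
Qed.

Lemma word_mass_ge0 Q w i : (forall i j, 0 <= Q i j) -> 0 <= word_mass Q w i.
Proof.
by move=> Q0; elim: w i => //= a w IH i; apply: sumr_ge0 => j _; rewrite mulr_ge0.
Qed.

Lemma sum_letters (f : 'I_A -> 'I_B -> R) :
  \sum_a \sum_(j | Phi j == a) f a j = \sum_j f (Phi j) j.
Proof.
rewrite [RHS](partition_big Phi xpredT)//=; apply: eq_bigr => a _.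
by apply: eq_bigr => j /eqP ->.
Qed.

Lemma sum_tuple_cons (n : nat) (F : seq 'I_A -> R) :
  \sum_(w : n.+1.-tuple 'I_A) F w = \sum_a \sum_(w : n.-tuple 'I_A) F (a :: w).
Proof.
rewrite pair_big/= (reindex (fun p : 'I_A * n.-tuple 'I_A => [tuple of p.1 :: p.2]))//=.
exists (fun w : n.+1.-tuple 'I_A => (thead w, [tuple of behead w])) => [[a w] _|w _] /=.
  by congr pair; apply: val_inj.
by rewrite -tuple_eta.
Qed.

Lemma sum_tuple0 (F : seq 'I_A -> R) : \sum_(w : 0.-tuple 'I_A) F w = F [::].
Proof.
rewrite (eq_bigr (fun=> F [::])) => [|w _]; last by rewrite tuple0.
by rewrite sumr_const card_tuple expn0.
Qed.

Lemma sum_tuple_rec Q (G : seq 'I_A -> 'I_B -> R) (n : nat) i :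
  (forall a w i, G (a :: w) i = \sum_(j | Phi j == a) Q i j * G w j) ->
  \sum_(w : n.+1.-tuple 'I_A) G w i =
    \sum_j Q i j * \sum_(w : n.-tuple 'I_A) G w j.
Proof.
move=> hG; rewrite (sum_tuple_cons _ (G ^~ i)).
under eq_bigr => a _.
  under eq_bigr do rewrite hG.
  rewrite exchange_big/=.
  over.
rewrite (sum_letters (fun a j => \sum_(w : n.-tuple 'I_A) Q i j * G w j)).
by apply: eq_bigr => j _; rewrite mulr_sumr.
Qed.

(** Row sums above 1 are allowed, for use with a matrix of norm bounds; the exponent [n.+1] is the
    length of [rcons w a]. *)
Lemma sum_word_mass_le Q (M : R) n i : (forall i j, 0 <= Q i j) -> 0 <= M ->
  (forall i, \sum_j Q i j <= M) ->
  \sum_(w : n.-tuple 'I_A) \sum_a word_mass Q (rcons w a) i <= M ^+ n.+1.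
Proof.
move=> Q0 M0 QM; elim: n i => [|n IH] i.
  rewrite (sum_tuple0 (fun w => \sum_a word_mass Q (rcons w a) i)) /=.
  rewrite (sum_letters (fun a j => Q i j * 1)) expr1.
  by under eq_bigr do rewrite mulr1.
rewrite (sum_tuple_rec (Q := Q)
  (G := fun w i => \sum_a word_mass Q (rcons w a) i)); last first.
  move=> a w k; rewrite exchange_big/=.
  by apply: eq_bigr => j _; rewrite mulr_sumr.
apply: (@le_trans _ _ (\sum_j Q i j * M ^+ n.+1)).
  by apply: ler_sum => j _; rewrite ler_wpM2l.
by rewrite -mulr_suml [leRHS]exprS ler_wpM2r ?exprn_ge0.
Qed.

End Words.

(** * Doeblin constants when each column is zero or bounded below *)

Section PositiveColumns.
Context {R : realType} {A B : nat} (Phi : 'I_B -> 'I_A) (Q : 'M[R]_B) (c : R).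
Hypothesis c0 : 0 < c.
Hypothesis c1 : c <= 1.
Hypothesis Q0 : forall i j, 0 <= Q i j.
Hypothesis Q1 : forall i, \sum_j Q i j = 1.
Hypothesis Qcol : forall j, (forall i, Q i j = 0) \/ (forall i, c <= Q i j).
Hypothesis Qletter : forall a, exists2 j, Phi j = a & forall i, c <= Q i j.
Local Notation mass := (word_mass Phi Q).
Local Notation kernel := (word_kernel Phi Q).

Lemma entry_le1 i j : Q i j <= 1.
Proof.
by rewrite -(Q1 i) (bigD1 j)//= lerDl; apply: sumr_ge0 => k _; exact: Q0.
Qed.

Lemma entry_ratio i k j : c * Q k j <= Q i j.
Proof.
have [h|h] := Qcol j; first by rewrite !h mulr0.
by apply: le_trans (h i); rewrite ler_piMr ?(ltW c0)// entry_le1.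
Qed.

Lemma letter_mass_ge a (f : 'I_B -> R) M i : (forall j, M <= f j) -> 0 <= M ->
  c * M <= \sum_(j | Phi j == a) Q i j * f j.
Proof.
move=> hf M0; have [j ja hj] := Qletter a.
rewrite (bigD1 j) ?ja//= -[leLHS]addr0 lerD//.
  by rewrite ler_pM// ltW.
by apply: sumr_ge0 => k _; rewrite mulr_ge0// (le_trans M0).
Qed.

Lemma mass_gt0 w i : 0 < mass w i.
Proof.
elim: w i => [|a w IH] i /=; first exact: ltr01.
have [j ja hj] := Qletter a.
rewrite (bigD1 j) ?ja//= ltr_pwDl// ?mulr_gt0//.
  exact: lt_le_trans (hj i).
by apply: sumr_ge0 => k _; rewrite mulr_ge0// ltW.
Qed.

(** The initial state enters a word mass only through the first row used, so the comparison of rows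
    carries over with the same [c] for all lengths. *)
Lemma mass_ratio w i k : c * mass w k <= mass w i.
Proof.
case: w => [|a w] /=; first by rewrite mulr1.
rewrite mulr_sumr; apply: ler_sum => j _; rewrite mulrA.
by apply: ler_wpM2r (entry_ratio _ _ _); exact: ltW (mass_gt0 _ _).
Qed.

Lemma mass_quotient_le a w i j : mass w j / mass (a :: w) i <= (c ^+ 2)^-1.
Proof.
rewrite ler_pdivrMr ?mass_gt0// ler_pdivlMl ?exprn_gt0// expr2 -mulrA.
apply: letter_mass_ge => [k|]; first exact: mass_ratio.
by rewrite mulr_ge0// ltW// mass_gt0.
Qed.

Lemma mass_quotient_ge0 a w i j : 0 <= mass w j / mass (a :: w) i.
Proof. by rewrite divr_ge0// ltW// mass_gt0. Qed.

Lemma kernel_ge0 a w i j : 0 <= kernel a w i j.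
Proof. by rewrite mulr_ge0// mulr_ge0// mass_quotient_ge0. Qed.

Lemma kernel_sum1 a w i : \sum_j kernel a w i j = 1.
Proof. by rewrite word_kernel_sum1// gt_eqF// mass_gt0. Qed.

Lemma kernel_le1 a w i j : kernel a w i j <= 1.
Proof.
rewrite -(kernel_sum1 a w i) (bigD1 j)//= lerDl; apply: sumr_ge0 => k _.
exact: kernel_ge0.
Qed.

(** One factor [c] comes from comparing the entries in rows [i] and [k], the other from comparing
    the normalizing masses. *)
Lemma kernel_doeblin a w i k j : c ^+ 2 * kernel a w k j <= kernel a w i j.
Proof.
rewrite /word_kernel mulrCA ler_wpM2l//.
have -> : c ^+ 2 * (Q k j * (mass w j / mass (a :: w) k)) =
  (c * Q k j) * (mass w j * (c / mass (a :: w) k)) by ring.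
apply: ler_pM => //; [by rewrite mulr_ge0// ltW| |exact: entry_ratio|].
  by rewrite mulr_ge0 ?divr_ge0 ?(ltW (mass_gt0 _ _))// ltW.
rewrite ler_wpM2l ?(ltW (mass_gt0 _ _))//.
by rewrite ler_pdivrMr ?mass_gt0// ler_pdivlMl ?mass_gt0// mulrC mass_ratio.
Qed.

(** For the empty past the positive column of the letter [a] gives [c]; a longer past only
    averages. *)
Lemma next_mass_bounds w a i : c <= next_mass Phi Q w a i <= 1.
Proof.
elim: w i => [|b w IH] i.
  rewrite /next_mass /= divr1; apply/andP; split.
    by rewrite -[leLHS]mulr1 letter_mass_ge.
  rewrite big_mkcond/= -[leRHS](Q1 i); apply: ler_sum => j _; rewrite mulr1.
  by case: ifP.
rewrite word_kernel_next => [|j]; last by rewrite gt_eqF// mass_gt0.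
rewrite -[c]mul1r -(kernel_sum1 b w i) mulr_suml; apply/andP; split.
  by apply: ler_sum => j _; rewrite ler_wpM2l ?kernel_ge0//; case/andP: (IH j).
apply: ler_sum => j _; rewrite -[leRHS]mulr1 ler_wpM2l ?kernel_ge0//.
by case/andP: (IH j).
Qed.

End PositiveColumns.

(** * Perturbation of the kernels *)

Section Perturbation.
Context {R : realType} {m A B : nat} (x0 : 'rV[R]_m) (r : R).
Context (D : 'rV[R]_m -> 'M[R]_B) (Phi : 'I_B -> 'I_A) (c eta delta : R).
Hypothesis r0 : 0 <= r.
Hypothesis c0 : 0 < c.
Hypothesis c1 : c <= 1.
Hypothesis D0 : forall i j, 0 <= D x0 i j.
Hypothesis D1 : forall x, cube x0 r x -> forall i, \sum_j D x i j = 1.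
Hypothesis Dcol : forall j,
  (forall i, D x0 i j = 0) \/ (forall i, c <= D x0 i j).
Hypothesis Dletter : forall a, exists2 j, Phi j = a & forall i, c <= D x0 i j.
Hypothesis Ddelta : forall i j,
  norm_le x0 r delta (fun x => D x i j - D x0 i j).
Hypothesis B0 : (0 < B)%N.
Hypothesis eta0 : 0 < eta.
Hypothesis eta_small : B%:R * eta <= c * c ^+ 2 / 64.
Hypothesis delta0 : 0 <= delta.
Hypothesis delta_small : B%:R * delta <= (c ^+ 2) ^+ 2 * eta / 8.

Local Notation mass x := (word_mass Phi (D x)).
Local Notation mass0 := (word_mass Phi (D x0)).
Local Notation kernel x := (word_kernel Phi (D x)).
Local Notation kernel0 := (word_kernel Phi (D x0)).
Local Notation next x := (next_mass Phi (D x)).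
Local Notation kappa := (c ^+ 2).
Local Notation eps := (delta / kappa).
Local Notation theta := (1 - kappa / 2).
Local Notation psi := (1 - kappa / 4).

Let D01 : forall i, \sum_j D x0 i j = 1.
Proof. exact: D1 (cube_center x0 r0). Qed.

Let kappa_gt0 : 0 < kappa. Proof. exact: exprn_gt0. Qed.
Let kappa_le1 : kappa <= 1. Proof. by rewrite exprn_ile1// ltW. Qed.
Let B1 : 1 <= B%:R :> R. Proof. by rewrite ler1n. Qed.
Let kappa_lec : c * kappa <= kappa. Proof. by rewrite ler_piMl// ltW. Qed.
Let eta_leB : eta <= B%:R * eta. Proof. by rewrite ler_peMl// ltW. Qed.
Let eta_le : eta <= kappa / 64. Proof. move: eta_leB kappa_lec eta_small. lra. Qed.
Let eps_ge0 : 0 <= eps. Proof. by rewrite divr_ge0// ltW. Qed.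
Let eps_small : B%:R * eps <= kappa * eta / 8.
Proof.
rewrite mulrA ler_pdivrMr//; apply: le_trans delta_small _.
by rewrite le_eqVlt; apply/orP; left; apply/eqP; ring.
Qed.
Let eps_leB : eps <= B%:R * eps. Proof. by rewrite ler_peMl. Qed.
Let kappa_eta : kappa * eta <= eta. Proof. by rewrite ler_piMl// ltW. Qed.
Let eta_le64 : eta <= 1 / 64. Proof. move: eta_le kappa_le1; lra. Qed.

Let mass0_gt0 w i : 0 < mass0 w i.
Proof. exact: (mass_gt0 c0 D0 Dletter). Qed.

(** The distortion of a word mass relative to the center. Its size may pick up a factor at every
    letter, so only the quotients between states are controlled: [projective] says that the vector
    of masses nearly keeps its direction. *)
Let ratio x w i := mass x w i / mass0 w i.
Let quotient x w i k := ratio x w i / ratio x w k.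
Let error x a w i j :=
  (Phi j == a)%:R * ((D x i j - D x0 i j) * (mass0 w j / mass0 (a :: w) i)).

Let projective w := forall i k, norm_le x0 r eta (fun x => quotient x w i k - 1).

Let ratio_neq0 x w i : projective w -> cube x0 r x -> ratio x w i != 0.
Proof.
move=> hw hx; have := norm_le_eval (hw i i) hx; apply: contraTneq => h.
by rewrite /quotient h mul0r sub0r normrN1 -ltNge; move: eta_le64 eta0; lra.
Qed.

Let mass_neq0 x w i : projective w -> cube x0 r x -> mass x w i != 0.
Proof.
move=> hw hx; have := ratio_neq0 i hw hx; apply: contraNneq => h.
by rewrite /ratio h mul0r.
Qed.

(** A Doob transform: in units of the masses at the center, prepending a letter acts as the central
    averaging kernel plus [error]. *)
Let ratio_cons x a w i : ratio x (a :: w) i =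
  \sum_j (kernel0 a w i j + error x a w i j) * ratio x w j.
Proof.
rewrite /ratio word_massE mulr_suml; apply: eq_bigr => j _.
have := lt0r_neq0 (mass0_gt0 w j); have := lt0r_neq0 (mass0_gt0 (a :: w) i).
rewrite /error /word_kernel.
by move: (mass0 (a :: w) i) (mass0 w j) => u v u0 v0; field; rewrite u0 v0.
Qed.

Let quotient_cons x a w i k : cube x0 r x -> projective w ->
  ratio x (a :: w) i / ratio x w k =
    \sum_j (kernel0 a w i j + error x a w i j) * quotient x w j k.
Proof.
move=> hx hw; rewrite ratio_cons mulr_suml.
by apply: eq_bigr => j _; rewrite -mulrA.
Qed.

Let error_le a w i j : norm_le x0 r eps (fun x => error x a w i j).
Proof.
apply: norm_leW (norm_leZ r0 _ (norm_leM r0 (Ddelta i j) (norm_le_cst x0 r _))).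
rewrite ger0_norm ?ler0n// (ger0_norm (mass_quotient_ge0 c0 D0 Dletter _ _ _ _)).
apply: (@le_trans _ _ (delta * (mass0 w j / mass0 (a :: w) i))).
  rewrite ler_piMl//; last by case: (_ == _); rewrite ?ler01.
  by rewrite mulr_ge0// (mass_quotient_ge0 c0 D0 Dletter).
by rewrite ler_wpM2l// (mass_quotient_le c0 c1 D0 D01 Dcol Dletter).
Qed.

Let quotient_le w j k : projective w ->
  norm_le x0 r (1 + eta) (fun x => quotient x w j k).
Proof.
move=> hw; rewrite -[X in X + _](@normr1 R).
apply: norm_le_ext (norm_leD (norm_le_cst x0 r 1) (hw j k)) => x _.
by rewrite addrC subrK.
Qed.

Let error_sum_le a w i k : projective w ->
  norm_le x0 r (B%:R * eps * (1 + eta))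
    (fun x => \sum_j error x a w i j * quotient x w j k).
Proof.
move=> hw; rewrite -mulrA -sum_const_ord; apply: norm_le_sum => j _.
by apply: norm_leM => //; exact: quotient_le.
Qed.

Let drift := eta + B%:R * eps * (1 + eta).

Let drift_le : drift <= 5 / 4 * eta.
Proof.
rewrite /drift; have : B%:R * eps * (1 + eta) <= eta / 8 * (1 + eta).
  rewrite ler_wpM2r ?addr_ge0 ?(ltW eta0)//.
  by move: eps_small kappa_eta eta0; lra.
have : eta * eta <= eta * (1 / 64) by rewrite ler_wpM2l// ltW.
move: eta_le64 eta0; lra.
Qed.

(** Averaging by [kernel0] fixes constants, so the scale moves by at most [eta], for the spread of
    the old ratios, plus the contribution of [error]. *)
Let ratio_cons_drift a w i k : projective w ->
  norm_le x0 r drift (fun x => ratio x (a :: w) i / ratio x w k - 1).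
Proof.
move=> hw.
have h1 : norm_le x0 r (\sum_j `|kernel0 a w i j| * eta)
    (fun x => \sum_j kernel0 a w i j * (quotient x w j k - 1)).
  by apply: norm_le_sum => j _; exact: norm_leZ.
have k1 := kernel_sum1 c0 D0 Dletter a w i.
have e1 : \sum_j `|kernel0 a w i j| * eta = eta.
  rewrite -mulr_suml -[RHS]mul1r -k1; congr (_ * _).
  by apply: eq_bigr => j _; rewrite ger0_norm// (kernel_ge0 c0 D0 Dletter).
rewrite e1 in h1.
apply: norm_le_ext (norm_leD h1 (error_sum_le a i k hw)) => x hx.
rewrite quotient_cons// -[X in _ = _ - X]k1 -big_split -sumrB/=.
by apply: eq_bigr => j _; ring.
Qed.

Let inverse_drift a w i k : projective w ->
  norm_le x0 r (1 - drift)^-1 (fun x => (ratio x (a :: w) i / ratio x w k)^-1).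
Proof.
move=> hw; apply: norm_le_inv => //; first by move: drift_le eta_le64 eta0; lra.
apply: norm_le_ext (norm_leN r0 (ratio_cons_drift a i k hw)) => x _.
by rewrite opprB.
Qed.

Let projective_nil : projective [::].
Proof.
move=> i k; apply: norm_leW (ltW eta0) _.
by apply: norm_le_ext (norm_le0 x0 r) => x _; rewrite /quotient /ratio /= !divr1 subrr.
Qed.

(** The bound [eta] reproduces itself: Doeblin's condition shrinks the spread by [1 - kappa], the
    two error terms give back at most a quarter of [kappa], and what remains of the gain absorbs the
    factor [1 + eta] and the renormalization by [1 - drift], as [eta <= kappa / 64]. *)
Let projective_cons a w : projective w -> projective (a :: w).
Proof.
move=> hw i k.
have h1 : norm_le x0 r ((1 - kappa) * (eta * (1 + eta)))
   (fun x => \sum_j kernel0 a w i j * quotient x w j k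
           - \sum_j kernel0 a w k j * quotient x w j k).
  apply: norm_le_doeblin.
  - exact: r0.
  - by move=> j; exact: (kernel_ge0 c0 D0 Dletter).
  - by move=> j; exact: (kernel_doeblin c0 c1 D0 D01 Dcol Dletter).
  - exact: (kernel_sum1 c0 D0 Dletter).
  - exact: (kernel_sum1 c0 D0 Dletter).
  (* The difference of two quotients over [k] is [(quotient x w j l - 1) * quotient x w l k]. *)
  move=> j l; apply: norm_le_ext (norm_leM r0 (hw j l) (quotient_le l k hw)) => x hx.
  rewrite /quotient; have := ratio_neq0 l hw hx; have := ratio_neq0 k hw hx.
  by move: (ratio x w l) (ratio x w k) => u v u0 v0; field; rewrite u0 v0.
have h2 := norm_leB r0 (error_sum_le a i k hw) (error_sum_le a k k hw).
have h3 := norm_leM r0 (norm_leD h1 h2) (inverse_drift a k k hw).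
apply: norm_leW (norm_le_ext _ h3).
  have d1 : 0 < 1 - drift by move: drift_le eta_le64 eta0; lra.
  rewrite ler_pdivrMr//.
  have e1 : B%:R * eps * (1 + eta) <= kappa * eta / 8 * (1 + eta).
    by rewrite ler_wpM2r// ?ler_wpDr ?ltW.
  have e2 : eta * drift <= eta * (5 / 4 * eta) by rewrite ler_wpM2l// ltW.
  have e3 : eta * eta <= eta * (kappa / 64) by rewrite ler_wpM2l// ltW.
  have e4 : 0 <= kappa * eta by rewrite mulr_ge0// ltW.
  have e5 : kappa * eta * eta >= 0 by rewrite mulr_ge0// ltW.
  move: drift_le eta_le64 eta_le kappa_le1 kappa_gt0 eta0; nra.
move=> x hx.
have n1 := ratio_neq0 k hw hx.
have n2 : ratio x (a :: w) k / ratio x w k != 0.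
  have := norm_le_eval (ratio_cons_drift a k k hw) hx; apply: contraTneq => ->.
  by rewrite sub0r normrN1 -ltNge; move: drift_le eta_le64 eta0; lra.
transitivity ((ratio x (a :: w) i / ratio x w k - ratio x (a :: w) k / ratio x w k) *
   (ratio x (a :: w) k / ratio x w k)^-1).
  rewrite [in RHS]quotient_cons// [X in (_ - X) * _]quotient_cons//.
  congr (_ * _); rewrite -!sumrB -big_split/=.
  by apply: eq_bigr => j _; ring.
move: n2; rewrite mulf_eq0 negb_or invr_eq0 => /andP[n2 _].
rewrite /quotient; move: (ratio x (a :: w) k) (ratio x w k) n1 n2 => u v u0 v0.
by field; rewrite u0 v0.
Qed.

Lemma word_projective w : projective w.
Proof. by elim: w => [|a w]; [exact: projective_nil|exact: projective_cons]. Qed.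

Lemma word_mass_neq0 x w i : cube x0 r x -> mass x w i != 0.
Proof. by move=> hx; apply: mass_neq0 => //; exact: word_projective. Qed.

Lemma norm_le_kernel a w i j :
  norm_le x0 r (2 * eta) (fun x => kernel x a w i j - kernel0 a w i j).
Proof.
have hw := word_projective w.
have k0 := kernel_ge0 c0 D0 Dletter a w i j.
have k1 := kernel_le1 c0 D0 Dletter a w i j.
(* With [q] the ratio of [a :: w] at [i] over that of [w] at [j], the difference of the kernels is
   [(error - kernel0 * (q - 1)) / q]. *)
have h1 := norm_leB r0 (error_le a w i j)
  (norm_leZ r0 (kernel0 a w i j) (ratio_cons_drift a i j hw)).
apply: norm_leW (norm_le_ext _ (norm_leM r0 h1 (inverse_drift a i j hw))).
  have d1 : 0 < 1 - drift by move: drift_le eta_le64 eta0; lra.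
  have d0 : 0 <= drift := norm_le_ge0 r0 (ratio_cons_drift a i j hw).
  rewrite ler_pdivrMr// ger0_norm//.
  have : kernel0 a w i j * drift <= drift by rewrite ler_piMl.
  have : eta * drift <= 1 / 64 * drift by rewrite ler_wpM2r.
  move: drift_le eps_leB eps_small kappa_eta eta0; lra.
move=> x hx; have n1 := ratio_neq0 j hw hx.
have n2 := ratio_neq0 i (word_projective (a :: w)) hx.
have e : kernel x a w i j =
    (kernel0 a w i j + error x a w i j) * (ratio x w j / ratio x (a :: w) i).
  have := word_mass_neq0 (a :: w) i hx.
  have := lt0r_neq0 (mass0_gt0 w j); have := lt0r_neq0 (mass0_gt0 (a :: w) i).
  rewrite /ratio /error /word_kernel.
  move: (mass0 (a :: w) i) (mass0 w j) (mass x (a :: w) i) => u v z u0 v0 z0.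
  by field; rewrite u0 v0 z0.
rewrite e; move: (ratio x w j) (ratio x (a :: w) i) n1 n2 => u v u0 v0.
by field; rewrite u0 v0.
Qed.

End Perturbation.

(** * Convergence of the entropies *)

Section WordEntropy.
Context {R : realType} {A B : nat} (Phi : 'I_B -> 'I_A) (Q : 'M[R]_B).

(** The initial state conditions both the weights and the logarithms: this is the entropy of the
    letter following [n] letters, given these and the start [i]. *)
Definition word_entropy (n : nat) (i : 'I_B) : R :=
  - \sum_(w : n.-tuple 'I_A) \sum_a
      word_mass Phi Q (rcons w a) i * ln (next_mass Phi Q w a i).

(** Splitting over the first state [j] gives both entropies the same weights. Only the logarithms
    differ: one sees the past [Phi j :: w] from [i], the other the past [w] from [j]. *)
Lemma word_entropy_defect n i :
  word_entropy n.+1 i - \sum_j Q i j * word_entropy n j =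
  \sum_(w : n.-tuple 'I_A) \sum_a \sum_j
    Q i j * word_mass Phi Q (rcons w a) j *
      (ln (next_mass Phi Q w a j) - ln (next_mass Phi Q (Phi j :: w) a i)).
Proof.
pose F b j := \sum_(w : n.-tuple 'I_A) \sum_a
  Q i j * word_mass Phi Q (rcons w a) j * ln (next_mass Phi Q (b :: w) a i).
have -> : word_entropy n.+1 i = - \sum_j F (Phi j) j.
  rewrite -sum_letters /word_entropy; congr (- _).
  rewrite (sum_tuple_cons _ (fun w => \sum_a
    word_mass Phi Q (rcons w a) i * ln (next_mass Phi Q w a i))).
  apply: eq_bigr => b _; rewrite /F [RHS]exchange_big/=; apply: eq_bigr => w _.
  rewrite [RHS]exchange_big/=; apply: eq_bigr => a _.
  by rewrite mulr_suml.
have -> : \sum_j Q i j * word_entropy n j = - \sum_j \sum_(w : n.-tuple 'I_A) \sum_a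
    Q i j * word_mass Phi Q (rcons w a) j * ln (next_mass Phi Q w a j).
  rewrite -sumrN; apply: eq_bigr => j _; rewrite mulrN; congr (- _).
  rewrite mulr_sumr; apply: eq_bigr => w _; rewrite mulr_sumr.
  by apply: eq_bigr => a _; rewrite mulrA.
rewrite opprK addrC -sumrB.
under [RHS]eq_bigr do rewrite exchange_big/=.
rewrite [RHS]exchange_big/=; apply: eq_bigr => j _.
rewrite /F -sumrB; apply: eq_bigr => w _; rewrite -sumrB.
by apply: eq_bigr => a _; rewrite mulrBr.
Qed.

End WordEntropy.

(** * Forgetting of the initial state, in norm *)

Section Contraction.
Context {R : realType} {m A B : nat} (x0 : 'rV[R]_m) (r : R).
Context (D : 'rV[R]_m -> 'M[R]_B) (Phi : 'I_B -> 'I_A) (c tau : R).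
Hypothesis r0 : 0 <= r.
Hypothesis c0 : 0 < c.
Hypothesis c1 : c <= 1.
Hypothesis D0 : forall i j, 0 <= D x0 i j.
Hypothesis D1 : forall x, cube x0 r x -> forall i, \sum_j D x i j = 1.
Hypothesis Dcol : forall j,
  (forall i, D x0 i j = 0) \/ (forall i, c <= D x0 i j).
Hypothesis Dletter : forall a, exists2 j, Phi j = a & forall i, c <= D x0 i j.
Local Notation mass x := (word_mass Phi (D x)).
Local Notation kernel x := (word_kernel Phi (D x)).
Local Notation next x := (next_mass Phi (D x)).
Local Notation kappa := (c ^+ 2).
Local Notation theta := (1 - kappa / 2).
Local Notation psi := (1 - kappa / 4).
Hypothesis tau0 : 0 <= tau.
Hypothesis tau_small : B%:R * tau <= c * kappa / 32.
Hypothesis Dtau : forall i j, norm_le x0 r tau (fun x => D x i j - D x0 i j).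
Hypothesis mass_neq0 : forall x w i, cube x0 r x -> mass x w i != 0.
Hypothesis kernel_tau : forall a w i j,
  norm_le x0 r tau (fun x => kernel x a w i j - kernel x0 a w i j).

Lemma x0_cube : cube x0 r x0. Proof. exact: cube_center. Qed.

Lemma kappa_bounds : [/\ 0 < kappa, kappa <= 1 & c * kappa <= kappa].
Proof.
have k0 : 0 < kappa by rewrite exprn_gt0.
by split=> //; [rewrite exprn_ile1// ltW|rewrite ler_piMl// ltW].
Qed.

Lemma Btau_bounds : [/\ 0 <= B%:R * tau, B%:R * tau <= kappa / 32,
  B%:R * tau <= c / 32 & B%:R * tau <= 1 / 32].
Proof.
have [k0 k1 kc] := kappa_bounds.
have ck : c * kappa <= c by rewrite ler_piMr// ltW.
by split; [rewrite mulr_ge0|move: tau_small kc; lra|move: tau_small ck; lra|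
  move: tau_small ck c1; lra].
Qed.

Lemma theta_bounds : 0 <= theta < 1 /\ theta <= psi < 1.
Proof. by have [? ? _] := kappa_bounds; split; apply/andP; split; lra. Qed.

Lemma next_cons x b w a i : cube x0 r x ->
  next x (b :: w) a i = \sum_j kernel x b w i j * next x w a j.
Proof. by move=> hx; apply: word_kernel_next => j; exact: mass_neq0. Qed.

Lemma next_nil x a i : next x [::] a i = \sum_(j | Phi j == a) D x i j.
Proof. by rewrite /next_mass /= divr1; apply: eq_bigr => j _; rewrite mulr1. Qed.

Lemma kernel_average x a w i : cube x0 r x -> \sum_j kernel x a w i j = 1.
Proof. by move=> hx; rewrite word_kernel_sum1// mass_neq0. Qed.

Lemma norm_le_entry i j : norm_le x0 r (D x0 i j + tau) (fun x => D x i j).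
Proof.
rewrite -[X in X + _](ger0_norm (D0 i j)).
apply: norm_le_ext (norm_leD (norm_le_cst x0 r _) (Dtau i j)) => x _.
by rewrite addrC subrK.
Qed.

Lemma norm_le_row_sum i (Q : pred 'I_B) :
  norm_le x0 r (1 + B%:R * tau) (fun x => \sum_(j | Q j) D x i j).
Proof.
apply: norm_leW (norm_le_sum (index_enum 'I_B) (fun j _ => norm_le_entry i j)).
rewrite big_split/= lerD//.
  rewrite -(D1 x0_cube i) [leRHS](bigID Q)/= lerDl.
  exact: sumr_ge0.
rewrite -sum_const_ord [leRHS](bigID Q)/= lerDl.
exact: sumr_ge0.
Qed.

(** The empty past gives two row sums, each of norm at most 2. Each further letter averages by
    Doeblin kernels; the perturbation takes back at most half of the gain [kappa], which leaves
    [theta]. *)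
Lemma norm_le_next_osc w a i k :
  norm_le x0 r (4 * theta ^+ size w) (fun x => next x w a i - next x w a k).
Proof.
have [Bt0 Bt1 Bt2 Bt3] := Btau_bounds.
have [k0 k1 _] := kappa_bounds; have [/andP[t0 _] _] := theta_bounds.
elim: w i k => [|b w IH] i k.
  apply: norm_leW (norm_le_ext _ (norm_leB r0 (norm_le_row_sum i (fun j => Phi j == a))
    (norm_le_row_sum k (fun j => Phi j == a)))).
    by rewrite expr0 mulr1; lra.
  by move=> x hx; rewrite !next_nil.
apply: norm_leW (norm_le_ext _ (@norm_le_average_osc _ _ x0 r _ r0
  (kernel x0 b w i) (kernel x0 b w k) (fun j x => kernel x b w i j)
  (fun j x => kernel x b w k j) kappa tau (fun j x => next x w a j) _ _ _ _ _ _ _ _ _ IH)).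
- rewrite /= (exprS theta) [leRHS]mulrCA ler_wpM2r//.
    by rewrite mulr_ge0// exprn_ge0.
  by lra.
- by move=> x hx; rewrite !next_cons.
- by move=> j; exact: (kernel_ge0 c0 D0 Dletter).
- by move=> j; exact: (kernel_doeblin c0 c1 D0 (D1 x0_cube) Dcol Dletter).
- exact: (kernel_sum1 c0 D0 Dletter).
- exact: (kernel_sum1 c0 D0 Dletter).
- by move=> x; exact: kernel_average.
- by move=> x; exact: kernel_average.
- by move=> j; exact: kernel_tau.
- by move=> j; exact: kernel_tau.
Qed.

Lemma next_center_bounds w a i : c <= next x0 w a i <= 1.
Proof. exact: (next_mass_bounds c0 D0 (D1 x0_cube) Dletter). Qed.

(* The errors made at each step add up to a geometric sum, because the
   oscillation of [next] decays. *)
Lemma norm_le_next_center w a i :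
  norm_le x0 r (c / 4 + c / 4 * (1 - theta ^+ size w))
    (fun x => next x w a i - next x0 w a i).
Proof.
have [Bt0 Bt1 Bt2 Bt3] := Btau_bounds.
have [k0 k1 _] := kappa_bounds; have [/andP[t0 _] _] := theta_bounds.
elim: w i => [|b w IH] i.
  rewrite expr0 subrr mulr0 addr0.
  have h : norm_le x0 r (\sum_(j < B | Phi j == a) tau)
      (fun x => \sum_(j < B | Phi j == a) (D x i j - D x0 i j)).
    by apply: norm_le_sum => j _; exact: Dtau.
  apply: norm_leW (norm_le_ext _ h) => [|x _]; last by rewrite !next_nil sumrB.
  apply: (@le_trans _ _ (B%:R * tau)); last by lra.
  rewrite -sum_const_ord [leRHS](bigID (fun j => Phi j == a))/= lerDl.
  exact: sumr_ge0.
have h1 := norm_le_average_sub r0 (kernel_tau b w i) (fun j => norm_le_next_osc w a j i).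
have h2 : norm_le x0 r (\sum_j `|kernel x0 b w i j| * (c / 4 + c / 4 * (1 - theta ^+ size w)))
    (fun x => \sum_j kernel x0 b w i j * (next x w a j - next x0 w a j)).
  by apply: norm_le_sum => j _; exact: norm_leZ.
have ks := kernel_sum1 c0 D0 Dletter b w i.
rewrite -mulr_suml (eq_bigr (kernel x0 b w i)) in h2; last first.
  by move=> j _; rewrite ger0_norm// (kernel_ge0 c0 D0 Dletter).
rewrite ks mul1r in h2.
apply: norm_leW (norm_le_ext _ (norm_leD h1 h2)).
  rewrite /= (exprS theta); have := exprn_ge0 (size w) t0.
  move: (theta ^+ size w) => p p0.
  (* The right-hand side is exactly the increment [c / 4 * (p - theta * p)] of the claimed bound,
     since [1 - theta = kappa / 2]; hence the 32 in [tau_small]. *)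
  have : B%:R * tau * (4 * p) <= c * kappa / 32 * (4 * p).
    by rewrite ler_wpM2r// mulr_ge0.
  lra.
move=> x hx /=.
have /= -> := @average_subE _ _ _ (kernel x0 b w i) (fun j x => kernel x b w i j)
  (fun j x => next x w a j) i x ks (kernel_average b w i hx).
rewrite (next_cons b w a i hx) (next_cons b w a i x0_cube).
under [X in _ + X = _]eq_bigr do rewrite mulrBr.
by rewrite sumrB; ring.
Qed.

Lemma norm_le_next_center_half w a i :
  norm_le x0 r (c / 2) (fun x => next x w a i - next x0 w a i).
Proof.
apply: norm_leW (norm_le_next_center w a i).
have [/andP[t0 _] _] := theta_bounds.
have : 0 <= c / 4 * theta ^+ size w by rewrite mulr_ge0 ?exprn_ge0// divr_ge0// ltW.
lra.
Qed.

Lemma next_ge x w a i : cube x0 r x -> c / 2 <= next x w a i.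
Proof.
move=> hx; have := norm_le_eval (norm_le_next_center_half w a i) hx.
have /andP[+ _] := next_center_bounds w a i.
by rewrite ler_norml; lra.
Qed.

Lemma next_gt0 x w a i : cube x0 r x -> 0 < next x w a i.
Proof. by move=> hx; apply: lt_le_trans (next_ge w a i hx); rewrite divr_gt0. Qed.

(** The deviation [c / 2] is at most half of the central value, which brings [next] within reach of
    [norm_le_inv] and [norm_le_ln1D]. *)
Lemma norm_le_next_rel w a i :
  norm_le x0 r (1 / 2) (fun x => (next x w a i - next x0 w a i) / next x0 w a i).
Proof.
have /andP[h1 h2] := next_center_bounds w a i.
have p0 : 0 < next x0 w a i := lt_le_trans c0 h1.
apply: norm_leW (norm_le_ext _
  (norm_leZ r0 (next x0 w a i)^-1 (norm_le_next_center_half w a i))).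
  rewrite gtr0_norm ?invr_gt0// ler_pdivrMl//; lra.
by move=> x _; rewrite mulrC.
Qed.

Lemma norm_le_next_inv w a i :
  norm_le x0 r (2 / c) (fun x => (next x w a i)^-1).
Proof.
have /andP[h1 h2] := next_center_bounds w a i.
have p0 : 0 < next x0 w a i := lt_le_trans c0 h1.
have h : norm_le x0 r (1 - 1 / 2)^-1 (fun x => (next x w a i / next x0 w a i)^-1).
  apply: norm_le_inv => //; first by lra.
  apply: norm_le_ext (norm_leN r0 (norm_le_next_rel w a i)) => x _.
  by field; rewrite gt_eqF.
apply: norm_leW (norm_le_ext _ (norm_leZ r0 (next x0 w a i)^-1 h)).
  rewrite gtr0_norm ?invr_gt0// mulrC.
  have -> : (1 - 1 / 2 : R)^-1 = 2 by field.
  by rewrite ler_wpM2l// lef_pV2 ?posrE.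
move=> x hx; have := next_gt0 w a i hx => q0.
by field; rewrite !gt_eqF.
Qed.

Lemma norm_le_next_ln w a i :
  norm_le x0 r (1 - ln c) (fun x => ln (next x w a i)).
Proof.
have /andP[h1 h2] := next_center_bounds w a i.
have p0 : 0 < next x0 w a i := lt_le_trans c0 h1.
have h3 : 1 / 2 < 1 :> R by lra.
have h := norm_le_ln1D r0 h3 (norm_le_next_rel w a i).
apply: norm_leW (norm_le_ext _ (norm_leD (norm_le_cst x0 r (ln (next x0 w a i))) h)).
  have -> : 1 / 2 / (1 - 1 / 2) = 1 :> R by field.
  rewrite addrC lerD2l ler0_norm ?ln_le0// lerN2.
  by rewrite ler_ln ?posrE.
move=> x hx; have q0 := next_gt0 w a i hx.
rewrite -lnM ?posrE//; last first.
  have -> : 1 + (next x w a i - next x0 w a i) / next x0 w a i =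
    next x w a i / next x0 w a i by field; rewrite gt_eqF.
  exact: divr_gt0.
by congr ln; field; rewrite gt_eqF.
Qed.

(** The constant of [norm_le_lnB] for the bounds [2 / c] and [1 - ln c], times the constant 8 of the
    increments of [next]. *)
Definition log_lipschitz := (2 * (2 / c) + 4 * (1 - ln c) * (2 / c)) * 8.

Lemma norm_le_ln_step b w a i j :
  norm_le x0 r (log_lipschitz * theta ^+ size w)
    (fun x => ln (next x (b :: w) a i) - ln (next x w a j)).
Proof.
have [Bt0 Bt1 Bt2 Bt3] := Btau_bounds.
have [/andP[t0 _] _] := theta_bounds.
have h : norm_le x0 r (8 * theta ^+ size w)
    (fun x => next x (b :: w) a i - next x w a j).
  apply: norm_leW (norm_le_ext _ (@norm_le_average_dist _ _ x0 r _ r0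
    (kernel x0 b w i) (fun j x => kernel x b w i j) tau
    (fun j x => next x w a j) _ j _ _ _ _ (fun k => norm_le_next_osc w a k j))).
  - rewrite mulrA ler_wpM2r ?exprn_ge0//; lra.
  - by move=> x hx; rewrite next_cons.
  - by move=> k; exact: (kernel_ge0 c0 D0 Dletter).
  - exact: (kernel_sum1 c0 D0 Dletter).
  - by move=> x; exact: kernel_average.
  - by move=> k; exact: kernel_tau.
rewrite /log_lipschitz -mulrA; apply: norm_le_lnB => //.
- by move=> x hx; exact: next_gt0.
- by move=> x hx; exact: next_gt0.
- exact: norm_le_next_inv.
- exact: norm_le_next_ln.
- exact: norm_le_next_ln.
Qed.

(** Norm bounds for the entries of [D]. A word mass is a polynomial in the entries with nonnegative
    coefficients, so its norm is bounded by its value at the majorant, whose row sums barely exceed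
    1. *)
Let majorant : 'M[R]_B := \matrix_(i, j) (D x0 i j + tau).

Let majorant_ge0 i j : 0 <= majorant i j.
Proof. by rewrite mxE addr_ge0. Qed.

Let majorant_sum i : \sum_j majorant i j <= 1 + B%:R * tau.
Proof.
under eq_bigr do rewrite mxE.
by rewrite big_split/= (D1 x0_cube) sum_const_ord.
Qed.

Lemma norm_le_word_mass w i :
  norm_le x0 r (word_mass Phi majorant w i) (fun x => mass x w i).
Proof.
elim: w i => [|a w IH] i /=.
  by rewrite -[X in norm_le _ _ X](@normr1 R); exact: norm_le_cst.
apply: norm_le_sum => j _; apply: norm_leM => //.
by rewrite mxE; exact: norm_le_entry.
Qed.

Local Notation entropy x := (word_entropy Phi (D x)).

Let C0 := 4 * log_lipschitz.
(** The first term makes [2 * C0 + (1 - kappa + 2 * (B%:R * tau)) * C1] at most [psi * C1]; the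
    second covers [n = 0]. *)
Let C1 := 8 * C0 / kappa + 4 * (1 - ln c).

Lemma log_lipschitz_ge0 : 0 <= log_lipschitz.
Proof.
have lc : ln c <= 0 by exact: ln_le0.
have q0 : 0 <= 2 / c by rewrite divr_ge0// ltW.
by rewrite mulr_ge0// addr_ge0// mulr_ge0// mulr_ge0// subr_ge0 (le_trans lc).
Qed.

(** The slow growth of the total norm of the masses is beaten by the forgetting rate:
    [(1 + B%:R * tau) * theta] is at most [psi], and the two extra factors are at most 2 each. *)
Lemma growth_le n : theta ^+ n * (1 + B%:R * tau) ^+ n.+2 <= 4 * psi ^+ n.
Proof.
have [Bt0 Bt1 Bt2 Bt3] := Btau_bounds; have [k0 k1 _] := kappa_bounds.
have [/andP[t0 _] _] := theta_bounds.
have -> : theta ^+ n * (1 + B%:R * tau) ^+ n.+2 =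
   (1 + B%:R * tau) ^+ 2 * ((1 + B%:R * tau) * theta) ^+ n.
  by rewrite -[n.+2]addn2 exprD exprMn; ring.
apply: ler_pM.
- by rewrite exprn_ge0// addr_ge0.
- by rewrite exprn_ge0// mulr_ge0// addr_ge0.
- have -> : 4 = 2 ^+ 2 :> R by ring.
  by rewrite lerXn2r ?nnegrE ?addr_ge0//; lra.
have psi0 : 0 <= psi by lra.
apply: lerXn2r; rewrite ?nnegrE//; first by rewrite mulr_ge0// addr_ge0.
have : B%:R * tau * theta <= kappa / 32 * 1.
  by apply: ler_pM => //; lra.
by move: k0; lra.
Qed.

Lemma norm_le_entropy_defect n i : norm_le x0 r (C0 * psi ^+ n)
  (fun x => entropy x n.+1 i - \sum_j D x i j * entropy x n j).
Proof.
have [/andP[t0 _] _] := theta_bounds.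
pose K := log_lipschitz * theta ^+ n.
have K0 : 0 <= K by rewrite mulr_ge0 ?log_lipschitz_ge0// exprn_ge0.
have h : norm_le x0 r (\sum_(w : n.-tuple 'I_A) \sum_a \sum_j
      majorant i j * word_mass Phi majorant (rcons w a) j * K)
    (fun x => \sum_(w : n.-tuple 'I_A) \sum_a \sum_j
      D x i j * mass x (rcons w a) j *
        (ln (next x w a j) - ln (next x (Phi j :: w) a i))).
  apply: norm_le_sum => w _; apply: norm_le_sum => a _; apply: norm_le_sum => j _.
  apply: norm_leM => //; first apply: norm_leM => //.
  - by rewrite mxE; exact: norm_le_entry.
  - exact: norm_le_word_mass.
  have := norm_leN r0 (norm_le_ln_step (Phi j) w a i j).
  rewrite size_tuple; apply: norm_le_ext => x _; by rewrite opprB.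
apply: norm_leW (norm_le_ext _ h) => [|x _]; last by rewrite word_entropy_defect.
apply: (@le_trans _ _ (K * (1 + B%:R * tau) ^+ n.+2)); last first.
  have -> : C0 * psi ^+ n = log_lipschitz * (4 * psi ^+ n).
    by rewrite /C0 [RHS]mulrCA mulrA.
  by rewrite /K -mulrA ler_wpM2l ?log_lipschitz_ge0// growth_le.
have e : \sum_(w : n.-tuple 'I_A) \sum_a \sum_j
      majorant i j * word_mass Phi majorant (rcons w a) j * K =
    K * \sum_j majorant i j * \sum_(w : n.-tuple 'I_A) \sum_a
      word_mass Phi majorant (rcons w a) j.
  under eq_bigr do rewrite exchange_big/=.
  rewrite exchange_big mulr_sumr/=; apply: eq_bigr => j _.
  rewrite !mulr_sumr; apply: eq_bigr => w _.
  rewrite !mulr_sumr; apply: eq_bigr => a _.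
  by rewrite mulrC.
have [Bt0 _ _ _] := Btau_bounds.
have p0 : 0 <= 1 + B%:R * tau by rewrite addr_ge0.
rewrite e ler_wpM2l// exprS.
apply: (@le_trans _ _ (\sum_j majorant i j * (1 + B%:R * tau) ^+ n.+1)).
  by apply: ler_sum => j _; rewrite ler_wpM2l// sum_word_mass_le.
by rewrite -mulr_suml ler_wpM2r ?exprn_ge0.
Qed.

Lemma norm_le_entropy0 i : norm_le x0 r (2 * (1 - ln c)) (fun x => entropy x 0%N i).
Proof.
have [Bt0 _ _ Bt3] := Btau_bounds.
have lc : 0 <= 1 - ln c := norm_le_ge0 r0 (norm_le_next_ln [::] (Phi i) i).
have h : norm_le x0 r (\sum_(w : 0.-tuple 'I_A) \sum_a
      word_mass Phi majorant (rcons w a) i * (1 - ln c))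
    (fun x => \sum_(w : 0.-tuple 'I_A) \sum_a
      mass x (rcons w a) i * ln (next x w a i)).
  apply: norm_le_sum => w _; apply: norm_le_sum => a _; apply: norm_leM => //.
    exact: norm_le_word_mass.
  exact: norm_le_next_ln.
apply: norm_leW (norm_leN r0 h).
under eq_bigr do rewrite -mulr_suml.
rewrite -mulr_suml ler_wpM2r//.
apply: le_trans (sum_word_mass_le Phi 0 i majorant_ge0 _ majorant_sum) _.
  by rewrite addr_ge0.
rewrite expr1; lra.
Qed.

(** Up to the defect, the entropies at stage [n.+1] are averages of those at stage [n] by the rows
    of [D], which themselves satisfy Doeblin's condition. *)
Lemma norm_le_entropy_osc n i k :
  norm_le x0 r (C1 * psi ^+ n) (fun x => entropy x n i - entropy x n k).
Proof.
have [Bt0 Bt1 Bt2 Bt3] := Btau_bounds.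
have [k0 k1 kc] := kappa_bounds; have [_ /andP[tp p1]] := theta_bounds.
have lc : 0 <= 1 - ln c := norm_le_ge0 r0 (norm_le_next_ln [::] (Phi i) i).
have C0ge : 0 <= C0 by rewrite mulr_ge0// log_lipschitz_ge0.
have C0k : 0 <= 8 * C0 / kappa.
  by apply: divr_ge0; [exact: mulr_ge0|exact: ltW].
have C1ge : 0 <= C1 by apply: addr_ge0 => //; exact: mulr_ge0.
elim: n i k => [|n IH] i k.
  apply: norm_leW (norm_leB r0 (norm_le_entropy0 i) (norm_le_entropy0 k)).
  rewrite expr0 mulr1 /C1.
  by move: C0k; lra.
have h1 := norm_leB r0 (norm_le_entropy_defect n i) (norm_le_entropy_defect n k).
have h2 := @norm_le_average_osc _ _ x0 r _ r0 (D x0 i) (D x0 k)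
  (fun j x => D x i j) (fun j x => D x k j) kappa tau (fun j x => entropy x n j) _
  (D0 k) _ (D1 x0_cube i) (D1 x0_cube k) (fun x hx => D1 hx i) (fun x hx => D1 hx k)
  (Dtau i) (Dtau k) IH.
apply: norm_leW (norm_le_ext _ (norm_leD h1 (h2 _))).
- rewrite (exprS psi).
  have -> : C1 * (psi * psi ^+ n) = (C1 * psi) * psi ^+ n by rewrite mulrA.
  have -> : C0 * psi ^+ n + C0 * psi ^+ n + (1 - kappa + 2 * (B%:R * tau)) * (C1 * psi ^+ n)
    = (C0 + C0 + (1 - kappa + 2 * (B%:R * tau)) * C1) * psi ^+ n by ring.
  rewrite ler_wpM2r ?exprn_ge0//; first by lra.
  have e : C1 * kappa = 8 * C0 + 4 * (1 - ln c) * kappa.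
    by rewrite /C1 mulrDl divfK// gt_eqF.
  have e1 : B%:R * tau * C1 <= kappa / 32 * C1 by rewrite ler_wpM2r.
  have e2 : 0 <= (1 - ln c) * kappa by rewrite mulr_ge0// ltW.
  move: C0ge e e1 e2; lra.
- by move=> x _; ring.
move=> j; apply: (le_trans _ (entry_ratio c0 D0 (D1 x0_cube) Dcol i k j)).
by rewrite ler_wpM2r// expr2 ler_piMl// ltW.
Qed.

Lemma norm_le_entropy_step n i : norm_le x0 r ((C0 + 2 * C1) * psi ^+ n)
  (fun x => entropy x n.+1 i - entropy x n i).
Proof.
have [Bt0 Bt1 Bt2 Bt3] := Btau_bounds.
have h := @norm_le_average_dist _ _ x0 r _ r0 (D x0 i) (fun j x => D x i j) tau
  (fun j x => entropy x n j) _ i (D0 i) (D1 x0_cube i) (fun x hx => D1 hx i)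
  (Dtau i) (fun k => norm_le_entropy_osc n k i).
apply: norm_leW (norm_le_ext _ (norm_leD (norm_le_entropy_defect n i) h)).
  have C1p : 0 <= C1 * psi ^+ n := norm_le_ge0 r0 (norm_le_entropy_osc n i i).
  have : B%:R * tau * (C1 * psi ^+ n) <= 1 / 32 * (C1 * psi ^+ n).
    by rewrite ler_wpM2r.
  lra.
by move=> x _; ring.
Qed.

Lemma word_entropy_limit : (0 < B)%N -> exists M, exists2 h, norm_le x0 r M h &
  forall x i, cube x0 r x -> entropy x n i @[n --> \oo] --> h x.
Proof.
move=> B0; pose i0 := Ordinal B0.
have [k0 k1 kc] := kappa_bounds; have [_ /andP[tp p1]] := theta_bounds.
have p01 : 0 <= psi < 1 by rewrite p1 andbT; lra.
have [h hM hlim] := norm_le_geometric_lim r0 p01 (norm_le_entropy0 i0)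
  (norm_le_entropy_step ^~ i0).
exists (2 * (1 - ln c) + (C0 + 2 * C1) / (1 - psi)), h => // x i hx.
(* The limit is built at [i0]; the vanishing oscillation transfers it to every initial state. *)
have z : entropy x n i - entropy x n i0 @[n --> \oo] --> (0 : R).
  have u : C1 * psi ^+ n @[n --> \oo] --> C1 * 0.
    apply: cvgM; first exact: cvg_cst.
    by apply: cvg_expr; case/andP: p01 => p0 _; rewrite ger0_norm.
  rewrite mulr0 in u; apply/norm_cvg0P; apply: squeeze_cvgr (cvg_cst _) u.
  apply: filterE => n; rewrite normr_ge0/=.
  exact: norm_le_eval (norm_le_entropy_osc n i i0) hx.
rewrite -[h x]add0r.
rewrite (_ : (fun n => entropy x n i) =
  (fun n => (entropy x n i - entropy x n i0) + entropy x n i0)); last first.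
  by apply/funext => n; rewrite subrK.
exact: cvgD z (hlim x hx).
Qed.

End Contraction.

(** * Hidden Markov chains *)

Section ConditionalEntropy.
Context {R : realType} {A B : nat} (Phi : 'I_B -> 'I_A) (Q : 'M[R]_B).
Context (mu : 'I_B -> R) (gamma omega : R) (n : nat).
Hypothesis Q0 : forall i j, 0 <= Q i j.
Hypothesis Q1 : forall i, \sum_j Q i j = 1.
Hypothesis mu0 : forall i, 0 <= mu i.
Hypothesis mu1 : \sum_i mu i = 1.
Hypothesis gamma0 : 0 < gamma.
Hypothesis omega0 : 0 <= omega.
Hypothesis next_gamma : forall (w : n.-tuple 'I_A) a i, gamma <= next_mass Phi Q w a i.
Hypothesis next_omega : forall (w : n.-tuple 'I_A) a i k,
  next_mass Phi Q w a i - next_mass Phi Q w a k <= omega.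

(** The probability of emitting [w] when the initial state, which emits nothing itself, has law
    [mu]. *)
Definition mixed_mass (w : seq 'I_A) : R := \sum_i mu i * word_mass Phi Q w i.

Lemma ln_sub_le_ratio (u v : R) : gamma <= u -> gamma <= v ->
  u - v <= omega -> ln u - ln v <= omega / gamma.
Proof.
move=> hu hv huv; have u0 := lt_le_trans gamma0 hu; have v0 := lt_le_trans gamma0 hv.
apply: (le_trans (ln_sub_le v0 u0)).
have [uv|uv] := leP v u.
  apply: ler_pM => //; [by rewrite subr_ge0|by rewrite invr_ge0 ltW|].
  by rewrite lef_pV2 ?posrE.
apply: (@le_trans _ _ 0).
  by rewrite pmulr_lle0 ?invr_gt0// subr_le0 ltW.
by rewrite divr_ge0// ltW.
Qed.

(** The quotient is the average of [next_mass] over the initial state under its law given [w]. *)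
Lemma mixed_next_bounds (w : n.-tuple 'I_A) a M N :
  (forall i, word_mass Phi Q w i != 0) ->
  (forall i, M <= next_mass Phi Q w a i <= N) ->
  M <= mixed_mass (rcons w a) / mixed_mass w <= N.
Proof.
move=> nz hMN.
have m0 i : 0 <= word_mass Phi Q w i by exact: word_mass_ge0.
have p0 : 0 < mixed_mass w.
  rewrite lt_neqAle eq_sym sumr_ge0 ?andbT => [|i _]; last by rewrite mulr_ge0.
  rewrite psumr_neq0 => [|i _]; last by rewrite mulr_ge0.
  have [i mi] : exists i, 0 < mu i.
    apply/not_existsP => h; move: (oner_eq0 R); rewrite -mu1 big1 ?eqxx// => i _.
    by apply/eqP; rewrite eq_le mu0 andbT leNgt; apply/negP; exact: h.
  by apply/hasP; exists i; rewrite ?mem_index_enum//= mulr_gt0// lt_neqAle eq_sym nz m0.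
have e : mixed_mass (rcons w a) =
    \sum_i (mu i * word_mass Phi Q w i) * next_mass Phi Q w a i.
  by apply: eq_bigr => i _; rewrite -mulrA /next_mass [X in _ = _ * X]mulrC divfK.
rewrite ler_pdivlMr// ler_pdivrMr// e /mixed_mass !mulr_sumr; apply/andP; split.
  by apply: ler_sum => i _; rewrite mulrC ler_wpM2l ?mulr_ge0//; case/andP: (hMN i).
by apply: ler_sum => i _; rewrite mulrC ler_wpM2r ?mulr_ge0//; case/andP: (hMN i).
Qed.

(** Revealing the initial state changes each conditional probability by at most [omega], hence its
    logarithm by at most [omega / gamma]; the weights add up to at most 1. *)
Lemma mixed_entropy_close :
  (forall (w : n.-tuple 'I_A) i, word_mass Phi Q w i != 0) ->
  `|- \sum_(w : n.-tuple 'I_A) \sum_a mixed_mass (rcons w a) *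
        ln (mixed_mass (rcons w a) / mixed_mass w)
    - \sum_i mu i * word_entropy Phi Q n i| <= omega / gamma.
Proof.
move=> nz.
have e : - \sum_(w : n.-tuple 'I_A) \sum_a mixed_mass (rcons w a) *
        ln (mixed_mass (rcons w a) / mixed_mass w)
    - \sum_i mu i * word_entropy Phi Q n i =
  \sum_(w : n.-tuple 'I_A) \sum_a \sum_i mu i * word_mass Phi Q (rcons w a) i *
    (ln (next_mass Phi Q w a i) - ln (mixed_mass (rcons w a) / mixed_mass w)).
  have -> : \sum_i mu i * word_entropy Phi Q n i =
    - \sum_(w : n.-tuple 'I_A) \sum_a \sum_i mu i * word_mass Phi Q (rcons w a) i *
      ln (next_mass Phi Q w a i).
    rewrite -sumrN; under [RHS]eq_bigr do rewrite exchange_big/= -sumrN.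
    rewrite [RHS]exchange_big/=; apply: eq_bigr => i _.
    rewrite mulrN sumrN mulr_sumr; congr (- _); apply: eq_bigr => w _.
    by rewrite mulr_sumr; apply: eq_bigr => a _; rewrite mulrA.
  rewrite opprK addrC -sumrB; apply: eq_bigr => w _.
  rewrite -sumrB; apply: eq_bigr => a _.
  rewrite mulr_suml -sumrB; apply: eq_bigr => i _; by rewrite mulrBr.
rewrite e.
have total : \sum_(w : n.-tuple 'I_A) \sum_a \sum_i mu i * word_mass Phi Q (rcons w a) i <= 1.
  under eq_bigr do rewrite exchange_big/=.
  rewrite exchange_big/= -mu1; apply: ler_sum => i _.
  under eq_bigr do rewrite -mulr_sumr.
  rewrite -mulr_sumr ler_piMr//.
  apply: le_trans (sum_word_mass_le Phi n i Q0 ler01 _) _ => [k|]; first by rewrite Q1.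
  by rewrite expr1n.
have wp : 0 <= omega / gamma by rewrite divr_ge0// ltW.
apply: (@le_trans _ _ (\sum_(w : n.-tuple 'I_A) \sum_a \sum_i
   mu i * word_mass Phi Q (rcons w a) i * (omega / gamma))).
  apply: (le_trans (ler_norm_sum _ _ _)); apply: ler_sum => w _.
  apply: (le_trans (ler_norm_sum _ _ _)); apply: ler_sum => a _.
  apply: (le_trans (ler_norm_sum _ _ _)); apply: ler_sum => i _.
  have m0 : 0 <= mu i * word_mass Phi Q (rcons w a) i.
    by rewrite mulr_ge0// word_mass_ge0.
  rewrite normrM ger0_norm// ler_wpM2l//.
  set q := mixed_mass _ / _; set s := next_mass _ _ _ _ i.
  have /andP[q1 q2] : s - omega <= q <= s + omega.
    apply: mixed_next_bounds => // k.
    have := next_omega w a i k; have := next_omega w a k i.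
    by rewrite -/s => h1 h2; apply/andP; split; lra.
  have qg : gamma <= q.
    have /andP[//] : gamma <= q <= s + omega.
    apply: mixed_next_bounds => // k; rewrite next_gamma/=.
    have := next_omega w a k i; rewrite -/s => h1; lra.
  have sg : gamma <= s by exact: next_gamma.
  rewrite ler_norml -lerNl opprB; apply/andP; split.
    by apply: ln_sub_le_ratio => //; lra.
  by apply: ln_sub_le_ratio => //; lra.
under eq_bigr do under eq_bigr do rewrite -mulr_suml.
under eq_bigr do rewrite -mulr_suml.
by rewrite -mulr_suml ler_piMl.
Qed.

End ConditionalEntropy.

(** * Random variables with finitely many values *)

Section Chain.
Context {R : realType} {d : measure_display} {T : measurableType d}.
Context (P : probability T R).

Lemma total_probability (I : finType) (f : T -> I) (E : set T) :
  (forall i, measurable (f @^-1` [set i])) -> measurable E ->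
  fine (P E) = \sum_i fine (P (E `&` f @^-1` [set i])).
Proof.
move=> mf mE.
have mEf i : measurable (E `&` f @^-1` [set i]) by exact: measurableI.
have cover : E = \bigcup_(i in [set` enum I]) (E `&` f @^-1` [set i]).
  apply/seteqP; split => [t Et|t [i _ []]//].
  by exists (f t) => //=; rewrite mem_enum.
rewrite {1}cover measure_fin_bigcup//; last first.
  apply/trivIsetP => i j _ _ ij; apply/seteqP; split => // t.
  by move=> [[_ /= ->] [_ /= ji]]; move: ij; rewrite ji eqxx.
rewrite -fsbig_seq ?enum_uniq// big_enum/= sum_fine// => i _.
exact: fin_num_measure.
Qed.

Lemma expectation_finite (I : finType) (f : T -> I) (G : I -> R) :
  (forall i, measurable (f @^-1` [set i])) ->
  ('E_P[fun t => G (f t)])%E = (\sum_i G i * fine (P (f @^-1` [set i])))%:E.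
Proof.
move=> mf.
have cover : \big[setU/set0]_(i <- enum I) (f @^-1` [set i]) = [set: T].
  rewrite -bigcup_seq; apply/seteqP; split => // t _.
  by exists (f t) => //=; rewrite mem_enum.
rewrite unlock -cover integral_bigsetU_EFin ?enum_uniq//.
- rewrite big_enum/= -sumEFin; apply: eq_bigr => i _.
  rewrite (@eq_integral _ _ _ _ _ (cst (G i)%:E)) => [|t]; last by rewrite inE/= => ->.
  by rewrite integral_cst//= EFinM fineK// fin_num_measure.
- apply/trivIsetP => i j _ _ ij; apply/seteqP; split => // t [/= ->] /eqP.
  by rewrite (negPf ij).
rewrite cover; apply/measurable_realfun.measurable_EFinP => _ U mU; rewrite setTI.
have -> : (fun t => G (f t)) @^-1` U = \bigcup_(i in [set i | U (G i)]) (f @^-1` [set i]).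
  apply/seteqP; split => [t Ut|t [i Ui /= fti]]; first by exists (f t).
  by rewrite /= fti.
by apply: fin_bigcup_measurable => //; exact: finite_finset.
Qed.

End Chain.

(** * Law of the words emitted by the chain *)

Section HiddenChain.
Context {R : realType} {d : measure_display} {T : measurableType d}.
Context (P : probability T R).

(** Cylinders over plain sequences, in a recursive form suited to induction on words. *)
Fixpoint follows {S : Type} (X : int -> T -> S) (s : int) (w : seq S) : set T :=
  if w is a :: w' then X s @^-1` [set a] `&` follows X (s + 1) w' else setT.

Lemma followsP (S : Type) (X : int -> T -> S) s w t :
  follows X s w t <-> [seq X (s + Posz i) t | i <- iota 0 (size w)] = w.
Proof.
elim: w s => [|a w IH] s //=; rewrite addr0 (iotaDl 1) -map_comp.
rewrite (eq_map (g := fun i => X (s + 1 + Posz i) t)) => [|i]; last first.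
  by rewrite /= PoszD addrA.
by split=> [[/= <- /IH ->]//|[<- e]]; split=> //; exact/IH.
Qed.

Lemma cylinderE (S : Type) (X : int -> T -> S) s n (w : n.-tuple S) :
  cylinder X s w = follows X s w.
Proof.
have blockE t : block X s n t = [seq X (s + Posz i) t | i <- iota 0 n] :> seq S.
  by rewrite -val_enum_ord -map_comp.
apply/seteqP; split => t.
  by move=> /= <-; apply/followsP; rewrite size_tuple blockE.
by move/followsP; rewrite size_tuple -blockE => /= e; exact: val_inj.
Qed.

Lemma follows_rcons (S : Type) (X : int -> T -> S) s w a :
  follows X s (rcons w a) =
    follows X s w `&` X (s + Posz (size w)) @^-1` [set a].
Proof.
elim: w s => [|b w IH] s /=; first by rewrite setTI setIT addr0.
by rewrite IH setIA -addrA -PoszD add1n.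
Qed.

Context {A B : nat} (Phi : 'I_B -> 'I_A) (Q : 'M[R]_B) (Y : int -> T -> 'I_B).
Hypothesis chain : stationary_markov_chain P Y Q.
Local Notation Z := (fun (k : int) (t : T) => Phi (Y k t)).

Lemma measurable_state k i : measurable (Y k @^-1` [set i]).
Proof. by case: chain => -[]. Qed.

Lemma measurable_letter k a : measurable (Z k @^-1` [set a]).
Proof.
have -> : Z k @^-1` [set a] = \bigcup_(i in [set i | Phi i = a]) (Y k @^-1` [set i]).
  apply/seteqP; split => [t Zt|t [i /= <- /= <-]//]; by exists (Y k t).
apply: fin_bigcup_measurable => [|i _]; [exact: finite_finset|exact: measurable_state].
Qed.

Lemma measurable_follows (S : Type) (X : int -> T -> S) s w :
  (forall k a, measurable (X k @^-1` [set a])) -> measurable (follows X s w).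
Proof.
by move=> mX; elim: w s => [|a w IH] s /=; [exact: measurableT|exact: measurableI].
Qed.

Lemma markov_step s v j i :
  fine (P (follows Y s (rcons (rcons v j) i))) =
    fine (P (follows Y s (rcons v j))) * Q j i.
Proof.
rewrite [in LHS]follows_rcons size_rcons.
have sz : size (rcons v j) == (size v).+1 by rewrite size_rcons.
have := chain.2 s (size v) (Tuple sz) i.
rewrite cylinderE /= (tnth_nth j) /= nth_rcons ltnn eqxx.
set E := follows Y s (rcons v j); set F := Y _ @^-1` _; rewrite (setIC E F).
have mE : measurable E by apply: measurable_follows => *; exact: measurable_state.
have mF : measurable F by exact: measurable_state.
(* For a null past the Markov property says nothing, but both sides vanish. *)
have [PE _|PE /(_ isT)] := eqVneq (P E) 0%E.
  suff -> : P (F `&` E) = 0%E by rewrite PE mul0r.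
  apply/eqP; rewrite eq_le measure_ge0 andbT -PE.
  by apply: le_measure; rewrite ?inE//; exact: measurableI.
rewrite /cond_prob => <-; rewrite mulrC divfK// fine_eq0//.
exact: fin_num_measure.
Qed.

(** Induction on [w] by splitting over the next state. The past [v] is general because each step
    appends a state to it. *)
Lemma path_emits s v j w :
  fine (P (follows Y s (rcons v j) `&` follows Z (s + Posz (size v).+1) w)) =
    fine (P (follows Y s (rcons v j))) * word_mass Phi Q w j.
Proof.
elim: w v j => [|a w IH] v j; first by rewrite setIT mulr1.
set k := s + _; set F := follows Y s (rcons v j).
have mF : measurable F by apply: measurable_follows => ? ?; exact: measurable_state.
have mG l u : measurable (follows Z l u).
  by apply: measurable_follows => ? ?; exact: measurable_letter.
rewrite (total_probability (f := Y k) P); last 2 first.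
- by move=> i; exact: measurable_state.
- exact: measurableI.
rewrite /= mulr_sumr [RHS]big_mkcond/=; apply: eq_bigr => i _.
case: eqP => [ia|ia]; last first.
  rewrite (_ : _ `&` _ = set0) ?measure0//; apply/seteqP; split => // t.
  by move=> [[_ [/= Za _]] /= Yi]; apply: ia; rewrite -Yi.
have -> : F `&` (Z k @^-1` [set a] `&` follows Z (k + 1) w) `&` Y k @^-1` [set i] =
    follows Y s (rcons (rcons v j) i) `&` follows Z (s + Posz (size (rcons v j)).+1) w.
  rewrite follows_rcons size_rcons -/k.
  have -> : s + Posz (size v).+2 = k + 1 by rewrite /k -addrA -PoszD addn1.
  apply/seteqP; split => t /=; first by move=> [[? [? ?]] ?].
  by move=> [[? Yi] ?]; rewrite /= Yi.
by rewrite IH markov_step mulrA.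
Qed.

Lemma emits_law s w :
  fine (P (follows Z s w)) =
    mixed_mass Phi Q (fun i => fine (P (Y (s - 1) @^-1` [set i]))) w.
Proof.
rewrite (total_probability (f := Y (s - 1)) P); last 2 first.
- by move=> i; exact: measurable_state.
- by apply: measurable_follows => ? ?; exact: measurable_letter.
apply: eq_bigr => i _; have := path_emits (s - 1) [::] i w.
by rewrite /= setIT subrK setIC.
Qed.

Lemma state_sum1 k : \sum_i fine (P (Y k @^-1` [set i])) = 1.
Proof.
have := total_probability (f := Y k) P (measurable_state k) measurableT.
rewrite probability_setT /= => ->; by apply: eq_bigr => i _; rewrite setTI.
Qed.

(** The initial state sits at time [- n - 1], one step before the block, since [word_mass] counts
    letters from the next state on. *)
Lemma conditional_entropyE n (mu := fun i => fine (P (Y (- Posz n - 1) @^-1` [set i]))) :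
  - fine ('E_P[fun t => ln (cond_likelihood P Z n t)])%E =
  - \sum_(w : n.-tuple 'I_A) \sum_a mixed_mass Phi Q mu (rcons w a) *
        ln (mixed_mass Phi Q mu (rcons w a) / mixed_mass Phi Q mu w).
Proof.
pose f t := (block Z (- Posz n) n t, Z 0 t).
have fE (w : n.-tuple 'I_A) a : f @^-1` [set (w, a)] = follows Z (- Posz n) (rcons w a).
  rewrite follows_rcons size_tuple addNr -cylinderE.
  by apply/seteqP; split => t /=; [case=> <- <-|case=> <- <-].
have lawE u : fine (P (follows Z (- Posz n) u)) = mixed_mass Phi Q mu u.
  exact: emits_law.
pose G (p : n.-tuple 'I_A * 'I_A) :=
  ln (mixed_mass Phi Q mu (rcons p.1 p.2) / mixed_mass Phi Q mu p.1).
have -> : (fun t => ln (cond_likelihood P Z n t)) = (fun t => G (f t)).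
  apply/funext => t; rewrite /cond_likelihood /cond_prob cylinderE /G; congr (ln (_ / _)).
    rewrite -lawE follows_rcons size_tuple addNr setIC; congr (fine (P (_ `&` _))).
  by rewrite -lawE.
rewrite (expectation_finite (f := f) P) => [|[w a]]; last first.
  by rewrite fE; apply: measurable_follows => ? ?; exact: measurable_letter.
rewrite /= pair_big/=; congr (- _); apply: eq_bigr => -[w a] _.
by rewrite fE lawE mulrC.
Qed.

End HiddenChain.

Lemma positive_entries_ge (R : realType) (B : nat) (Q : 'M[R]_B) :
  (forall i j, Q i j <= 1) ->
  exists2 c, 0 < c <= 1 & forall i j, 0 < Q i j -> c <= Q i j.
Proof.
(* With all entries at most 1, the product of the positive ones lies below each of them; it is 1 if
   there are none. *)
move=> Q1; exists (\prod_(p : 'I_B * 'I_B | 0 < Q p.1 p.2) Q p.1 p.2).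
  by rewrite prodr_gt0//=; apply: prodr_ile1 => p p0; rewrite ltW/=.
move=> i j Qij; rewrite (bigD1 (i, j))//= ler_piMr ?(ltW Qij)//.
by apply: prodr_ile1 => p /andP[p0 _]; rewrite ltW/=.
Qed.

(** At cost [omega n / gamma] the conditional entropy of the letters becomes an average of
    [word_entropy] over the initial state. Every state has the same limit [h], so these averages
    tend to [h] whatever their weights. *)
Lemma entropy_rate_cvg (R : realType) (A B : nat) (Phi : 'I_B -> 'I_A)
    (Q : 'M[R]_B) (d : measure_display) (T : measurableType d)
    (P : probability T R) (Y : int -> T -> 'I_B) (h gamma : R) (omega : R^nat) :
  stochastic Q -> stationary_markov_chain P Y Q -> 0 < gamma ->
  (forall w i, word_mass Phi Q w i != 0) ->
  (forall w a i, gamma <= next_mass Phi Q w a i) ->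
  (forall w a i k, next_mass Phi Q w a i - next_mass Phi Q w a k <= omega (size w)) ->
  omega n @[n --> \oo] --> 0 ->
  (forall i, word_entropy Phi Q n i @[n --> \oo] --> h) ->
  entropy_rate P (fun k t => Phi (Y k t)) = h.
Proof.
move=> [Q0 Q1] chain gamma0 nz next_gamma next_omega omega_lim ent_lim.
rewrite /entropy_rate; apply: cvg_lim => //.
set H := (fun n : nat => _).
have bound n : `|H n - h| <= omega n / gamma + \sum_i `|word_entropy Phi Q n i - h|.
  rewrite /H (conditional_entropyE Phi chain)/=.
  set mu := (fun i => fine (P (Y (- Posz n - 1) @^-1` [set i]))).
  have mu0 i : 0 <= mu i by exact: fine_ge0.
  have mu1 : \sum_i mu i = 1 by exact: state_sum1 chain _.
  have muI i : mu i <= 1.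
    by rewrite -mu1 (bigD1 i)//= lerDl; apply: sumr_ge0.
  have [i0 _|noB] := pickP 'I_B; last first.
    exfalso; move: mu1; rewrite big_pred0 => [/eqP|j]; last by have := noB j.
    by rewrite eq_sym oner_eq0.
  have omega0 : 0 <= omega n.
    have := next_omega (nseq n (Phi i0)) (Phi i0) i0 i0.
    by rewrite subrr size_nseq.
  rewrite -(subrKA (\sum_i mu i * word_entropy Phi Q n i)).
  apply: (le_trans (ler_normD _ _)); apply: lerD.
    apply: mixed_entropy_close => // w a i k.
    by have := next_omega w a i k; rewrite size_tuple.
  rewrite -[h in leLHS]mul1r -mu1 mulr_suml -sumrB.
  apply: (le_trans (ler_norm_sum _ _ _)); apply: ler_sum => i _.
  by rewrite -mulrBr normrM ger0_norm// ler_piMl.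
have z : omega n / gamma + \sum_i `|word_entropy Phi Q n i - h| @[n --> \oo]
    --> 0 * gamma^-1 + \sum_(i < B) `|h - h|.
  apply: cvgD; first by apply: cvgM => //; exact: cvg_cst.
  apply: (@cvg_sum_seq _ nat \oo _ _ (fun i n => `|word_entropy Phi Q n i - h|)) => i.
  by apply: cvg_norm; apply: cvgB; [exact: ent_lim|exact: cvg_cst].
rewrite mul0r add0r subrr normr0 big1// in z.
apply/subr_cvg0/norm_cvg0P; apply: squeeze_cvgr (cvg_cst _) z.
by apply: filterE => n; rewrite normr_ge0/=.
Qed.

Theorem theorem1p1 (R : realType) (m A B : nat)
    (Delta : 'rV[R]_m -> 'M[R]_B) (Phi : 'I_B -> 'I_A) (e0 : 'rV[R]_m)
    (d : measure_display) (T : 'rV[R]_m -> measurableType d)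
    (P : forall e : 'rV[R]_m, probability (T e) R)
    (Y : forall e : 'rV[R]_m, int -> T e -> 'I_B)
    (hDelta : analytic_parametrization Delta e0)
    (hY : forall e : 'rV[R]_m, stochastic (Delta e) ->
       stationary_markov_chain (P e) (Y e) (Delta e))
    (h1 : forall a : 'I_A, exists j : 'I_B,
       Phi j = a /\ forall i : 'I_B, 0 < Delta e0 i j)
    (h2 : forall j : 'I_B,
       (forall i : 'I_B, Delta e0 i j = 0) \/
       (forall i : 'I_B, 0 < Delta e0 i j)) :
  real_analytic_within [set e | stochastic (Delta e)]
    (fun e => entropy_rate (P e) (fun (k : int) (t : T e) => Phi (Y e k t)))
    e0.
Proof.
have [an rows [D0 D1]] := hDelta.
have B0 : (0 < B)%N.
  rewrite lt0n; apply/eqP => B0; subst B.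
  have := state_sum1 (hY e0 (conj D0 D1)) 0.
  by rewrite big_ord0 => /eqP; rewrite eq_sym oner_eq0.
have BR : 0 < B%:R :> R by rewrite ltr0n.
have [c /andP[c0 c1] cD] := positive_entries_ge (entry_le1 D0 D1).
have Dcol j : (forall i, Delta e0 i j = 0) \/ (forall i, c <= Delta e0 i j).
  by have [?|h] := h2 j; [left|right=> i; exact: cD].
have Dletter a : exists2 j, Phi j = a & forall i, c <= Delta e0 i j.
  by have [j [ja h]] := h1 a; exists j => // i; exact: cD.
have k0 : 0 < c ^+ 2 by rewrite exprn_gt0.
have k1 : c ^+ 2 <= 1 by rewrite exprn_ile1// ltW.
(* [eta], and then [delta], turn the two smallness conditions of the perturbation argument into
   equalities; the radius is chosen last. *)
pose eta := c * c ^+ 2 / 64 / B%:R.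
have eta0 : 0 < eta by rewrite !divr_gt0// mulr_gt0.
have etaB : B%:R * eta = c * c ^+ 2 / 64 by rewrite mulrC divfK// gt_eqF.
pose delta := (c ^+ 2) ^+ 2 * eta / 8 / B%:R.
have delta0 : 0 < delta by rewrite !divr_gt0// mulr_gt0// exprn_gt0.
have deltaB : B%:R * delta = (c ^+ 2) ^+ 2 * eta / 8 by rewrite mulrC divfK// gt_eqF.
have delta_eta : delta <= 2 * eta.
  apply: (@le_trans _ _ (B%:R * delta)); first by rewrite ler_peMl ?ler1n// ltW.
  rewrite deltaB.
  have : (c ^+ 2) ^+ 2 * eta <= 1 * eta by rewrite ler_wpM2r ?exprn_ile1// ltW.
  by move: eta0; lra.
have hr i j : \forall r \near 0^'+,
    norm_le e0 r delta (fun x => Delta x i j - Delta e0 i j).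
  have [coef hcoef] := nbhs_singleton (an i j).
  apply: (@power_series_norm_le _ _ e0 coef) delta0.
  by apply: filterS hcoef => x [l [hl ->]].
have [r1 r10 hr1] := (near_cubeP e0 _).1 rows.
have [r [r0 rr1 Ddelta]] : exists r, [/\ 0 < r, r < r1 &
    forall i j, norm_le e0 r delta (fun x => Delta x i j - Delta e0 i j)].
  have hall : \forall r \near 0^'+, forall i j,
      norm_le e0 r delta (fun x => Delta x i j - Delta e0 i j).
    by apply: filter_forall => i; apply: filter_forall => j; exact: hr.
  have /filter_ex[r [? [? ?]]] : \forall r \near (0 : R)^'+, 0 < r /\ r < r1 /\
      forall i j, norm_le e0 r delta (fun x => Delta x i j - Delta e0 i j).
    apply: filterI; first exact: nbhs_right_gt.
    by apply: filterI => //; exact: nbhs_right_lt.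
  by exists r.
have rge0 := ltW r0.
have Drow x : cube e0 r x -> forall i, \sum_j Delta x i j = 1.
  by move=> hx; apply: hr1 => i; apply: (le_trans (hx i)); exact: ltW.
have eta_small : B%:R * eta <= c * c ^+ 2 / 64 by rewrite etaB.
have delta_small : B%:R * delta <= (c ^+ 2) ^+ 2 * eta / 8 by rewrite deltaB.
have nz x w i (hx : cube e0 r x) := word_mass_neq0 rge0 c0 c1 D0 Drow Dcol
  Dletter Ddelta B0 eta0 eta_small (ltW delta0) delta_small w i hx.
have kern := norm_le_kernel rge0 c0 c1 D0 Drow Dcol
  Dletter Ddelta B0 eta0 eta_small (ltW delta0) delta_small.
(* The contraction argument runs with [tau = 2 * eta], the bound for the kernels, which also covers
   the entries because [delta <= 2 * eta]. *)
have tau0 : 0 <= 2 * eta by rewrite mulr_ge0// ltW.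
have tau_small : B%:R * (2 * eta) <= c * c ^+ 2 / 32.
  by rewrite mulrCA etaB; lra.
have Dtau i j := norm_leW delta_eta (Ddelta i j).
have [M [h hM hlim]] := word_entropy_limit rge0 c0 c1 D0 Drow Dcol Dletter tau0 tau_small
  Dtau nz kern B0.
have [coef hcoef] := norm_le_power_series r0 hM.
have rcube : \forall x \near e0, cube e0 r x by apply/near_cubeP; exists r.
exists coef; near=> x; exists (h x); split; first by near: x.
have hx : cube e0 r x by near: x.
move=> /= st.
have [/andP[t0 t1] _] := theta_bounds c0 c1.
apply: (@entropy_rate_cvg _ _ _ _ _ _ _ _ _ _ (c / 2)
  (fun n => 4 * (1 - c ^+ 2 / 2) ^+ n) st (hY _ st)).
- by rewrite divr_gt0.
- by move=> w i; exact: nz.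
- move=> w a i; exact: (next_ge rge0 c0 c1 D0 Drow Dcol Dletter tau0 tau_small
    Dtau nz kern).
- move=> w a i k; apply: le_trans (ler_norm _) _.
  exact: (norm_le_eval (norm_le_next_osc rge0 c0 c1 D0 Drow Dcol Dletter tau0 tau_small
    Dtau nz kern w a i k) hx).
- rewrite -[X in _ --> X](mulr0 4); apply: cvgM; first exact: cvg_cst.
  by apply: cvg_expr; rewrite ger0_norm.
- by move=> i; exact: hlim.
Unshelve. all: by end_near.
Qed.
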